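(* Let $\mathcal{E}$ be a finite-dimensional Euclidean space, let $\mathcal{X},\mathcal{Y}\subseteq\mathcal{E}$ be $C^1$ embedded submanifolds, and let $Z\in\mathcal{X}\cap\mathcal{Y}$. Then $\mathcal{X}$ and $\mathcal{Y}$ are intrinsically transversal at $Z$ if and only if they intersect cleanly at $Z$, i.e., there exists a neighborhood $\mathcal{B}$ of $Z$ such that $\mathcal{X}\cap\mathcal{Y}\cap\mathcal{B}$ is a $C^1$ embedded submanifold of $\mathcal{E}$ and $$\mathrm{T}_{\mathcal{X}\cap\mathcal{Y}}(X)=\mathrm{T}_{\mathcal{X}}(X)\cap\mathrm{T}_{\mathcal{Y}}(X)\quad\text{for all }X\in\mathcal{X}\cap\mathcal{Y}\cap\mathcal{B}.$$
   Context: $\mathrm{T}_{\mathcal{S}}(S)$ and $\mathrm{N}_{\mathcal{S}}(S)=\mathrm{T}_{\mathcal{S}}(S)^\perp$ denote the tangent and normal spaces of a submanifold $\mathcal{S}$ at $S$, and $\mathrm{dist}(y,\mathcal{C})=\inf_{x\in\mathcal{C}}\|x-y\|$. Intrinsic transversality of $\mathcal{X},\mathcal{Y}$ at $Z\in\mathcal{X}\cap\mathcal{Y}$: there exist a constant $\kappa\in(0,1]$ and a neighborhood of $Z$ such that for all $X\in\mathcal{X}\setminus\mathcal{Y}$ and $Y\in\mathcal{Y}\setminus\mathcal{X}$ in this neighborhood, with $u=(X-Y)/\|X-Y\|$, $$\max\{\mathrm{dist}(u,\mathrm{N}_{\mathcal{Y}}(Y)),\ \mathrm{dist}(u,-\mathrm{N}_{\mathcal{X}}(X))\}\ge\kappa.$$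 *)

(* Defs.v *)
From HB Require Import structures.
From mathcomp Require Import all_boot all_order all_algebra.
From mathcomp Require Import all_classical all_reals all_analysis.
Set Implicit Arguments.
Unset Strict Implicit.
Unset Printing Implicit Defensive.
Import Order.TTheory GRing.Theory Num.Theory.
Import numFieldNormedType.Exports.
Local Open Scope classical_set_scope.
Local Open Scope ring_scope.

#[short(type="normedVectType")]
HB.structure Definition NormedVector (R : numFieldType) :=
  { E of NormedModule R E & Vector R E }.

(* The library norm on E, hence its topology and differentials, comes from
   the inner product. *)
Definition euclidean (R : realType) (E : normedVectType R)
    (dot : {dot E for idfun}) : Prop :=
  forall x : E, `|x| ^+ 2 = dot x x.

Section C1.
Variables (R : realType) (E F : normedModType R).

(* y |-> 'd h y is continuous for the operator norm. *)
Definition C1_on (h : E -> F) (U : set E) : Prop :=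
  (forall x, U x -> differentiable h x) /\
  (forall x, U x -> forall e : R, 0 < e ->
     \forall y \near x, forall v : E, `|'d h y v - 'd h x v| <= e * `|v|).

End C1.

Section Submanifold.
Variables (R : realType) (E : normedVectType R) (dot : {dot E for idfun}).
Implicit Types S A : set E.

(* Local defining functions h : U -> R^k, of constant codimension k; k = 0 is
   the case of open sets.  Only the values of h on the open set U matter. *)
Definition C1_embedded_submanifold S : Prop :=
  exists k : nat, forall x, S x ->
    exists (U : set E) (h : E -> 'rV[R]_k),
      [/\ open_nbhs x U,
          C1_on h U,
          S `&` U = [set y | U y /\ h y = 0] &
          forall w : 'rV[R]_k, exists v : E, 'd h x v = w].

(* Velocities at x of the curves in S that are C^1 around 0. *)
Definition tangent S (x : E) : set E :=
  [set v | exists (I : set R) (c : R -> E),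
     [/\ open_nbhs (0 : R) I,
         @C1_on R R^o E c I,
         forall t, I t -> S (c t),
         c 0 = x &
         derive1 c 0 = v]].

Definition normal S (x : E) : set E :=
  [set w | forall v, tangent S x v -> dot w v = 0].

Definition dist (y : E) A : R := inf [set `|x - y| | x in A].

Definition intrinsically_transversal (X Y : set E) (Z : E) : Prop :=
  exists (kappa : R) (B : set E),
    [/\ 0 < kappa <= 1, nbhs Z B &
      forall x y, (X `\` Y) x -> (Y `\` X) y -> B x -> B y ->
        let u := `|x - y|^-1 *: (x - y) in
        kappa <= Num.max (dist u (normal Y y)) (dist u (-%R @` normal X x))].

(* B is taken open, so that X `&` Y and its submanifold X `&` Y `&` B have the
   same tangent space at every point of B. *)
Definition intersect_cleanly (X Y : set E) (Z : E) : Prop :=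
  exists B : set E,
    [/\ open_nbhs Z B,
        C1_embedded_submanifold (X `&` Y `&` B) &
        forall x, (X `&` Y `&` B) x ->
          tangent (X `&` Y) x = tangent X x `&` tangent Y x].

End Submanifold.

(* Main.v *)
Require Import Defs.
From HB Require Import structures.
From mathcomp Require Import all_boot all_order all_algebra.
From mathcomp Require Import all_classical all_reals all_analysis.
From mathcomp Require Import ring lra.
Set Implicit Arguments.
Unset Strict Implicit.
Unset Printing Implicit Defensive.
Import Order.TTheory GRing.Theory Num.Theory.
Import numFieldNormedType.Exports VectorInternalTheory.
Local Open Scope classical_set_scope.
Local Open Scope ring_scope.

(** Write [X], [Y] near [Z] as zero loci of submersions [f], [g].  All estimates
    are quantitative and rest on two facts: strict differentiability, and Graves'
    theorem [d(s, f^-1(0)) <= C |f s|], proved by minimising [|f y| + |y - s|/(2C)]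
    over a closed ball.

    Clean implies transversal: let [h] define the intersection [M], let [x] in [X],
    [y] in [Y], and let [z] be a point of [M] nearest to [x].  Graves' theorem gives
    [|x - z| <= C |Dh (x - z)|], and [ker Df /\ ker Dg <= ker Dh] turns this into
    [|x - z|, |y - z| <= P |x - y|].  Since [x - z] and [y - z] are almost tangent,
    a unit vector [u = (x - y)/|x - y|] close to both normal spaces would give
    [|x - y| = <u, x - z> - <u, y - z> < |x - y|].

    Transversal implies clean: minimising [|x - y| + s (|x - x0| + |y - y0|)] over
    [X * Y] with [s < kappa] yields, by the slope condition, a point [m] of [M] with
    [|m - x0| <= C |x0 - y0|].  Choose linear [A1], [A2] such that [A1 Df + A2 Dg] is
    onto with kernel [ker Df /\ ker Dg]; then [T = {A1 f + A2 g = 0}] is a submanifold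
    containing [M].  For [s] in [T] with nearest point [z] in [M], both [f s] and [g s]
    are [o(|s - z|)], hence so is the distance from [s] to [M], i.e. [|s - z|]: so
    [s = z], and [T] coincides with [M] near [Z]. *)

(** * Finite-dimensional normed spaces *)

Section FiniteDim.
Variable R : realType.

Lemma lipschitz_within (V W : normedModType R) (A : set V) (f : V -> W) (K : R) :
  (forall x y, A x -> A y -> `|f x - f y| <= K * `|x - y|) ->
  {within A, continuous f}.
Proof.
move=> fK; apply/subspace_continuousP => x Ax; apply/cvgrPdist_le => e e0.
rewrite near_withinE /=; have K0 : 0 < `|K| + 1 by rewrite ltr_wpDl.
have : \forall y \near x, `|x - y| <= e / (`|K| + 1).
  by apply: (cvgrPdist_le _ _).1; [exact: cvg_id | rewrite divr_gt0].
apply: filterS => y xy Ay; apply: le_trans (fK _ _ Ax Ay) _.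
apply: (@le_trans _ _ ((`|K| + 1) * `|x - y|)).
  by rewrite ler_wpM2r// (le_trans (ler_norm _))// lerDl.
by rewrite mulrC -ler_pdivlMr.
Qed.

Lemma lipschitz_min (V : normedModType R) (A : set V) (f : V -> R) (K : R) :
  A !=set0 -> compact A ->
  (forall x y, A x -> A y -> `|f x - f y| <= K * `|x - y|) ->
  exists2 c, A c & forall x, A x -> f c <= f x.
Proof.
move=> A0 cA /(@lipschitz_within V R A f K) fc.
have [c /set_mem Ac cmin] := compact_EVT_min A0 cA fc.
by exists c => // x Ax; apply: cmin; exact/mem_set.
Qed.

Lemma coord_le_norm n (v : 'rV[R]_n) i : `|v 0 i| <= `|v|.
Proof.
rewrite {2}/Num.norm /= mx_normrE.
exact: (le_bigmax _ (fun ij => `|v ij.1 ij.2|) (0, i)).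
Qed.

Lemma norm_rV_le n (v : 'rV[R]_n) (b : R) :
  0 <= b -> (forall i, `|v 0 i| <= b) -> `|v| <= b.
Proof.
move=> b0 vb; rewrite /Num.norm /= mx_normrE.
by apply/bigmax_leP; split => // -[i j] _ /=; rewrite ord1.
Qed.

Lemma rV_linear_bounded n (F : normedModType R) (f : {linear 'rV[R]_n -> F}) :
  exists2 K : R, 0 < K & forall v, `|f v| <= K * `|v|.
Proof.
exists (\sum_i `|f (delta_mx 0 i)| + 1); first by rewrite ltr_wpDl// sumr_ge0.
move=> v; rewrite {1}(row_sum_delta v) linear_sum mulrDl mul1r.
apply: (@le_trans _ _ (\sum_i `|f (delta_mx 0 i)| * `|v|)); last first.
  by rewrite mulr_suml lerDl.
apply: le_trans (ler_norm_sum _ _ _) _; apply: ler_sum => i _.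
by rewrite linearZ normrZ mulrC ler_wpM2l// coord_le_norm.
Qed.

Lemma unit_sphere_compact n : compact [set v : 'rV[R]_n | `|v| = 1].
Proof.
apply: bounded_closed_compact.
  by exists 1; split => // M M1 v /= ->; exact: ltW.
apply: ((continuous_closedP (Num.norm : 'rV[R]_n -> R)).1 _ [set x | x = 1]) => [v|].
  exact: norm_continuous.
exact: closed_eq.
Qed.

(** Equivalence of norms: the norm of [r2v a] attains its minimum on the compact unit sphere of
    coordinates, and this minimum is positive because [r2v] is injective. *)
Lemma r2v_lower (E : normedVectType R) :
  exists2 c : R, 0 < c & forall a, c * `|a| <= `|r2v a : E|.
Proof.
have [K K0 Kb] := @rV_linear_bounded _ E r2v.
have [[a0 a01]|noS] := pselect (exists a : 'rV[R]_(dim E), `|a| = 1); last first.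
  (* An empty sphere means that [0] is the only vector, so any constant works. *)
  exists 1 => // a; have [->|a0] := eqVneq a 0; first by rewrite normr0 mulr0.
  exfalso; apply: noS; exists (`|a|^-1 *: a).
  by rewrite normrZ normfV normr_id mulVf// normr_eq0.
have [||m /= m1 mmin] := @lipschitz_min _ [set v : 'rV[R]_(dim E) | `|v| = 1]
    (fun a => `|r2v a : E|) K _ (@unit_sphere_compact _).
- by exists a0.
- move=> x y _ _; apply: le_trans (ler_dist_dist _ _) _.
  by rewrite -linearB.
exists `|r2v m : E|.
  rewrite normr_gt0; apply/eqP => /(congr1 v2r); rewrite r2vK linear0 => m0.
  by move: m1; rewrite m0 normr0 => /eqP; rewrite eq_sym oner_eq0.
move=> a; have [->|a0'] := eqVneq a 0; first by rewrite normr0 mulr0.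
have na : `|a| != 0 by rewrite normr_eq0.
have := mmin (`|a|^-1 *: a); rewrite normrZ normfV normr_id mulVf// => /(_ erefl).
by rewrite linearZ normrZ normfV normr_id mulrC ler_pdivlMr// normr_gt0.
Qed.

Lemma linear_bounded (E : normedVectType R) (F : normedModType R)
    (f : {linear E -> F}) :
  exists2 K : R, 0 < K & forall v, `|f v| <= K * `|v|.
Proof.
have [K K0 Kb] := @rV_linear_bounded _ _ (f \o (@r2v R E)).
have [c c0 cb] := r2v_lower E.
exists (K / c) => [|v]; first exact: divr_gt0.
have /= := Kb (v2r v); rewrite v2rK => /le_trans; apply.
have := cb (v2r v); rewrite v2rK => cv.
by rewrite -mulrA ler_wpM2l ?(ltW K0)// mulrC ler_pdivlMr// mulrC.
Qed.

Lemma linear_continuous_fd (E : normedVectType R) (F : normedModType R)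
    (f : {linear E -> F}) : continuous f.
Proof.
have [K K0 Kb] := linear_bounded f.
apply/continuous_subspace_setT/(@lipschitz_within _ _ _ _ K) => x y _ _.
by rewrite -linearB.
Qed.

Lemma closed_ball_norm_closed (V : normedModType R) (a : V) (r : R) :
  closed [set y | `|y - a| <= r].
Proof.
apply: ((continuous_closedP (fun y : V => `|y - a|)).1 _ [set t | t <= r]) => [v|];
  last exact: closed_le.
apply: cvg_norm.
by apply: cvgB; [exact: cvg_id | exact: cvg_cst].
Qed.

(** The ball is a closed subset of the image under [r2v] of a bounded closed set of coordinate
    vectors, which is compact by Heine-Borel. *)
Lemma closed_ball_fd_compact (E : normedVectType R) (a : E) (r : R) :
  compact [set y : E | `|y - a| <= r].
Proof.
have [c c0 cb] := r2v_lower E; have [K K0 Kb] := @rV_linear_bounded _ E r2v.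
set B := [set b : 'rV[R]_(dim E) | `|b - 0| <= (`|r| + `|a|) / c].
have cB : compact B.
  apply: bounded_closed_compact; last exact: closed_ball_norm_closed.
  exists ((`|r| + `|a|) / c); split; first exact: num_real.
  by move=> M M1 v /=; rewrite /B/= subr0 => /le_trans; apply; exact: ltW.
have cI : compact (r2v @` B : set E).
  apply: continuous_compact cB; apply: (@lipschitz_within _ _ _ _ K) => x y _ _.
  by rewrite -linearB.
apply: (subclosed_compact (@closed_ball_norm_closed _ a r) cI) => y /= ya.
exists (v2r y); last exact: v2rK.
rewrite /B/= subr0 ler_pdivlMr// mulrC; have := cb (v2r y); rewrite v2rK => /le_trans; apply.
have -> : y = (y - a) + a by rewrite subrK.
by apply: le_trans (ler_normD _ _) _; rewrite lerD2r (le_trans ya)// ler_norm.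
Qed.

(** Take [B] after a pseudo-inverse of [A]: the vector [v] and its image under the pseudo-inverse of
    [A] after [A] differ by an element of the kernel of [A], which [B] kills. *)
Lemma linear_factor (E F G : vectType R) (A : {linear E -> F})
    (B : {linear E -> G}) :
  (forall v, A v = 0 -> B v = 0) ->
  exists C : {linear F -> G}, forall v, B v = C (A v).
Proof.
move=> AB; exists (B \o ((linfun A)^-1)%VF) => v /=; apply/eqP.
rewrite -subr_eq0 -linearB; apply/eqP; apply: AB; rewrite linearB /=.
have AE x : A x = linfun A x by rewrite lfunE.
by rewrite !AE limg_lfunVK ?subrr// memv_img// memvf.
Qed.

Lemma linear_section (E F : vectType R) (D : {linear E -> F}) :
  (forall w, exists v, D v = w) -> exists L : {linear F -> E}, cancel L D.
Proof.
move=> Ds; exists ((linfun D)^-1)%VF => w.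
have DE x : D x = linfun D x by rewrite lfunE.
rewrite DE limg_lfunVK//; have [v <-] := Ds w.
by rewrite DE memv_img// memvf.
Qed.

End FiniteDim.

(** * Differentials and strict differentiability *)

Section EpsDelta.
Variable R : realType.

Lemma nbhs_ball_ex (V : normedModType R) (x : V) (P : set V) :
  nbhs x P -> exists2 r : R, 0 < r & forall y, `|y - x| < r -> P y.
Proof.
move=> /nbhs_normP[r /= r0 rP]; exists r => // y yx; apply: rP.
by rewrite /ball_ /= distrC.
Qed.

Lemma ball_nbhs_ex (V : normedModType R) (x : V) (P : set V) (r : R) :
  0 < r -> (forall y, `|y - x| < r -> P y) -> nbhs x P.
Proof.
move=> r0 rP; apply/nbhs_normP; exists r => // y /=.
by rewrite /ball_ /= distrC; exact: rP.
Qed.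

Lemma differentiable_eps (V W : normedModType R) (f : V -> W) (x : V) (e : R) :
  differentiable f x -> 0 < e ->
  exists2 r : R, 0 < r &
    forall y, `|y - x| < r -> `|f y - f x - 'd f x (y - x)| <= e * `|y - x|.
Proof.
move=> /diff_locally /eqaddoP fx e0.
have [r r0 rP] := nbhs_ball_ex (fx e e0).
exists r => // y yx; have := rP (y - x); rewrite subr0 => /(_ yx).
by rewrite !fctE /= subrK opprD addrA.
Qed.

Lemma eps_differentiable (V W : normedModType R) (f : V -> W) (x : V)
    (L : {linear V -> W}) :
  continuous L ->
  (forall e : R, 0 < e -> exists2 r : R, 0 < r &
    forall y, `|y - x| < r -> `|f y - f x - L (y - x)| <= e * `|y - x|) ->
  differentiable f x /\ 'd f x = L :> (V -> W).
Proof.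
move=> Lc fe; have fo : f \o shift x = cst (f x) + L +o_ 0 id.
  apply/eqaddoP => e e0; have [r r0 rP] := fe e e0.
  apply: (ball_nbhs_ex r0) => y; rewrite subr0 => yr.
  by rewrite !fctE /= opprD addrA; have := rP (y + x); rewrite addrK; apply.
have dfL := diff_unique Lc fo; split => //; apply/diff_locallyP.
by rewrite dfL.
Qed.

(** [C1_on] for curves speaks of differentials over [R^o], velocities of [derive1], and the mean
    value theorem of [is_derive]; one estimate delivers all three. *)
Lemma eps_differentiable1 (V : normedModType R) (f : R -> V) (t : R) (d : V) :
  (forall e : R, 0 < e -> exists2 r : R, 0 < r &
    forall s, `|s - t| < r -> `|f s - f t - (s - t) *: d| <= e * `|s - t|) ->
  [/\ @differentiable_def R R^o V f _ (Phantom _ (nbhs (t : R^o))),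
      (forall s, @diff R R^o V _ (Phantom _ (nbhs (t : R^o))) f s = s *: d),
      is_derive (t : R^o) 1 f d & derive1 f t = d].
Proof.
move=> fe.
pose D (s : R^o) : V := s *: d.
have D_lin : linear D by move=> ? ? ?; rewrite /D scalerDl scalerA.
pose DM := GRing.isLinear.Build _ _ _ _ _ D_lin.
pose L : {linear R^o -> V} := HB.pack D DM.
have Lc : continuous L by exact: scalel_continuous.
have [df dfE] := @eps_differentiable R^o V f t L Lc fe.
have isd : is_derive (t : R^o) 1 f d.
  apply: DeriveDef; first exact: diff_derivable.
  by rewrite deriveE// dfE /= /D scale1r.
split => //; first by move=> s; rewrite dfE.
by rewrite derive1E derive_val.
Qed.

Lemma real_mean_value (f df : R -> R) (e : R) :
  (forall t, 0 <= t <= 1 -> is_derive (t : R^o) 1 f (df t)) ->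
  (forall t, 0 <= t <= 1 -> `|df t| <= e) -> `|f 1 - f 0| <= e.
Proof.
move=> fd dfe.
have [||c] := @MVT _ f df 0 1 ltr01.
- move=> t; rewrite in_itv /= => /andP[t0 t1]; apply: fd.
  by rewrite (ltW t0) (ltW t1).
- apply: derivable_within_continuous => t; rewrite in_itv /= => t01.
  by have [] := fd t t01.
rewrite in_itv /= => /andP[c0 c1] ->; rewrite subr0 mulr1.
by apply: dfe; rewrite (ltW c0) (ltW c1).
Qed.

(** The map [h] minus its linearisation at [x] has differential of norm at most [e] near [x]; the
    mean value theorem along the segment from [z] to [y] concludes. Rows carry the sup norm, so
    arguing coordinatewise loses no constant. *)
Lemma C1_on_strict (E : normedModType R) (k : nat) (h : E -> 'rV[R]_k)
    (U : set E) (x : E) (e : R) :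
  open_nbhs x U -> C1_on h U -> 0 < e ->
  exists2 r : R, 0 < r & forall y, `|y - x| < r ->
    [/\ U y, (forall v, `|'d h y v - 'd h x v| <= e * `|v|) &
        forall z, `|z - x| < r ->
          `|h y - h z - 'd h x (y - z)| <= e * `|y - z|].
Proof.
move=> [oU Ux] [hd hC] e0.
have [r1 r10 r1U] := nbhs_ball_ex (open_nbhs_nbhs (conj oU Ux)).
have [r2 r20 r2C] := nbhs_ball_ex (hC x Ux e e0).
have r0 : 0 < Num.min r1 r2 by rewrite lt_min r10.
exists (Num.min r1 r2) => // y; rewrite lt_min => /andP[y1 y2].
split; [exact: r1U | exact: r2C |] => z; rewrite lt_min => /andP[z1 z2].
apply: norm_rV_le => [|i]; first by rewrite mulr_ge0// ltW.
pose p (t : R) := z + t *: (y - z).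
(* A convex combination, so the segment stays in the ball. *)
have pE t : p t - x = (1 - t) *: (z - x) + t *: (y - x).
  rewrite /p scalerBl scale1r -[RHS]addrA [X in _ = _ + X]addrC -scalerBr opprB addrA subrK.
  by rewrite addrAC.
have pr t (r : R) : 0 <= t <= 1 -> `|z - x| < r -> `|y - x| < r -> `|p t - x| < r.
  move=> /andP[t0 t1] zr yr; rewrite pE.
  apply: le_lt_trans (ler_normD _ _) _; rewrite !normrZ ger0_norm ?subr_ge0//.
  rewrite ger0_norm//; set m := Num.max `|z - x| `|y - x|.
  have mr : m < r by rewrite gt_max zr.
  have zm : `|z - x| <= m by rewrite le_max lexx.
  have ym : `|y - x| <= m by rewrite le_max lexx orbT.
  by apply: le_lt_trans mr; nra.
pose g t := h (p t) 0 i - t * ('d h x (y - z)) 0 i.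
suff : `|g 1 - g 0| <= e * `|y - z|.
  rewrite /g /p scale1r scale0r addr0 mul1r mul0r subr0 [z + _]addrC subrK.
  by rewrite !mxE addrAC.
apply: (@real_mean_value g
  (fun t => ('d h (p t) (y - z) - 'd h x (y - z)) 0 i)) => t t01.
- have [|_ _ +_] // := @eps_differentiable1 R g t
    (('d h (p t) (y - z) - 'd h x (y - z)) 0 i) => d d0.
  (* The [+ 1] avoids dividing by zero when [y = z]. *)
  have e'0 : 0 < d / (`|y - z| + 1) by rewrite divr_gt0// ltr_wpDl.
  have [r r0' rP] := differentiable_eps (hd (p t) (r1U _ (pr t r1 t01 z1 y1))) e'0.
  exists (r / (`|y - z| + 1)) => [|s st]; first by rewrite divr_gt0// ltr_wpDl.
  have pst : p s - p t = (s - t) *: (y - z).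
    by rewrite /p [z + _]addrC addrKA scalerBl.
  have := rP (p s); rewrite pst normrZ => H.
  have : `|s - t| * `|y - z| < r.
    apply: le_lt_trans (_ : `|s - t| * (`|y - z| + 1) < r).
      by rewrite ler_wpM2l// lerDl.
    by rewrite -ltr_pdivlMr// ltr_wpDl.
  move=> /H{}H; apply: le_trans (_ : d / (`|y - z| + 1) * (`|s - t| * `|y - z|) <= _).
    apply: le_trans H; apply: le_trans (coord_le_norm _ i).
    have dE : 'd h (p t) ((s - t) *: (y - z)) = (s - t) *: 'd h (p t) (y - z).
      exact: linearZ.
    rewrite dE le_eqVlt; apply/orP; left; apply/eqP; congr (`| _ |).
    transitivity (g s - g t - (s - t) * ('d h (p t) (y - z) - 'd h x (y - z)) 0 i).
      by [].
    by rewrite /g !mxE; ring.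
  rewrite [`|s - t| * _]mulrC mulrA ler_wpM2r// mulrAC.
  by rewrite ler_pdivrMr ?ltr_wpDl// ler_wpM2l ?(ltW d0)// lerDl.
- apply: le_trans (coord_le_norm _ i) _.
  by apply: r2C; exact: pr.
Qed.

End EpsDelta.

(** * Graves' theorem and tangent spaces of zero loci *)

Section Graves.
Variables (R : realType) (E : normedVectType R).

(** If the minimiser [c] had [f c] nonzero, a short step [t *: v] with [D v = - f c] would lower the
    norm of [f] by at least [t (1 - e C)] times that of [f c], while the penalty grows by at most
    half of [t] times it; as [e C <= 1/4], the objective would decrease. *)
Lemma graves (F : normedModType R) (f : E -> F) (D : {linear E -> F}) (x : E)
    (r e C : R) :
  0 < C -> 0 <= e -> e * C <= 4^-1 ->
  (forall w, exists2 v, D v = w & `|v| <= C * `|w|) ->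
  (forall y z, `|y - x| < r -> `|z - x| < r ->
     `|f y - f z - D (y - z)| <= e * `|y - z|) ->
  forall y0, `|y0 - x| < r / 2 -> 2 * C * `|f y0| < r / 2 ->
  exists y, [/\ `|y - x| < r, f y = 0 & `|y - y0| <= 2 * C * `|f y0|].
Proof.
move=> C0 e0 eC DC fD y0 y0x fy0.
have inball y : `|y - y0| <= r / 2 -> `|y - x| < r.
  move=> yy0; rewrite -(subrKA y0 y); apply: le_lt_trans (ler_normD _ _) _.
  rewrite [ltRHS](splitr r); exact: ler_ltD.
have r0 : 0 < r by have := normr_ge0 (y0 - x); lra.
have [K K0 KD] := linear_bounded D.
pose s := (2 * C)^-1; have s0 : 0 < s by rewrite invr_gt0 mulr_gt0.
have sC : s * C = 2^-1 by rewrite /s invfM -mulrA mulVf ?mulr1// gt_eqF.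
pose A := [set y : E | `|y - y0| <= r / 2].
have [|y z Ay Az|c cA cmin] := @lipschitz_min R E A
  (fun y => `|f y| + s * `|y - y0|) (K + e + s) _ (@closed_ball_fd_compact _ _ y0 (r / 2)).
- by exists y0; rewrite /A/= subrr normr0 divr_ge0// ltW.
- rewrite opprD addrACA -mulrBr mulrDl.
  apply: le_trans (ler_normD _ _) _; apply: lerD.
    apply: le_trans (ler_dist_dist _ _) _.
    rewrite -[f y - f z](subrK (D (y - z))) addrC mulrDl.
    by apply: le_trans (ler_normD _ _) _; apply: lerD; [exact: KD|
      apply: fD; exact: inball].
  rewrite normrM (ger0_norm (ltW s0)) ler_wpM2l ?(ltW s0)//.
  by apply: le_trans (ler_dist_dist _ _) _; rewrite opprB subrKA.
(* Comparing with the competitor [y0] gives the required bound, and puts [c] strictly inside the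
   ball, leaving the slack [d] below. *)
have cy0 : `|c - y0| <= 2 * C * `|f y0|.
  have Ay0 : A y0 by rewrite /A/= subrr normr0 divr_ge0// ltW.
  have := cmin _ Ay0; rewrite subrr normr0 mulr0 addr0 => fc.
  rewrite -ler_pdivrMl ?mulr_gt0// -/s.
  by apply: le_trans fc; rewrite lerDr.
exists c; split => //; first exact: inball.
apply/eqP; rewrite -normr_le0 leNgt; apply/negP => a0.
have [v Dv vC] := DC (- f c); rewrite normrN in vC.
pose d := r / 2 - `|c - y0|.
have d0 : 0 < d by rewrite subr_gt0 (le_lt_trans cy0).
pose t := Num.min 1 (d / (`|v| + 1)).
have v1 : 0 < `|v| + 1 by rewrite ltr_wpDl.
have t0 : 0 < t by rewrite lt_min ltr01 divr_gt0.
have t1 : t <= 1 by rewrite ge_min lexx.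
have tv : t * `|v| <= d.
  apply: le_trans (_ : t * (`|v| + 1) <= _); first by rewrite ler_wpM2l ?(ltW t0)// lerDl.
  by rewrite -ler_pdivlMr// ge_min lexx orbT.
have Ntv : `|t *: v| = t * `|v| by rewrite normrZ gtr0_norm.
have cA' : A (c + t *: v).
  rewrite /A/= addrAC; apply: le_trans (ler_normD _ _) _.
  by rewrite Ntv -lerBrDl.
have fy : `|f (c + t *: v)| <= e * (t * `|v|) + (1 - t) * `|f c|.
  have := fD (c + t *: v) c (inball _ cA') (inball _ cA).
  rewrite [c + _ - c]addrC addKr Ntv linearZ Dv => H.
  have {1}-> : f (c + t *: v) =
      (f (c + t *: v) - f c - t *: - f c) + (1 - t) *: f c.
    by rewrite scalerBl scale1r scalerN opprK addrACA subrK subrr addr0.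
  apply: le_trans (ler_normD _ _) _; apply: lerD => //.
  by rewrite normrZ ger0_norm// subr_ge0.
have := cmin _ cA'; rewrite addrAC => H1.
have H2 : `|c - y0 + t *: v| <= `|c - y0| + t * `|v|.
  by rewrite -Ntv; exact: ler_normD.
have H3 : s * `|c - y0 + t *: v| <= s * `|c - y0| + s * (t * `|v|).
  by rewrite -mulrDr ler_wpM2l// ltW.
have H4 : t * `|f c| <= (e + s) * (t * `|v|) by nra.
have H5 : (e + s) * (t * `|v|) <= (e + s) * (t * (C * `|f c|)).
  by rewrite ler_wpM2l ?addr_ge0 ?(ltW s0)// ler_wpM2l// ltW.
have H6 : (e + s) * (t * (C * `|f c|)) = (e * C + s * C) * (t * `|f c|) by ring.
have H7 : 0 < t * `|f c| by rewrite mulr_gt0.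
move: (le_trans H4 H5); rewrite H6 sC; nra.
Qed.

(** Graves' theorem for the affine map [A v - w], started at [0]. Its estimate holds globally, so
    the radius may be taken as large as [w] demands. *)
Lemma onto_perturb (F : normedModType R) (D A : {linear E -> F}) (e C : R) :
  0 < C -> 0 <= e -> e * C <= 4^-1 ->
  (forall w, exists2 v, D v = w & `|v| <= C * `|w|) ->
  (forall v, `|A v - D v| <= e * `|v|) ->
  forall w, exists2 v, A v = w & `|v| <= 2 * C * `|w|.
Proof.
move=> C0 e0 eC DC AD w; pose r := 4 * C * `|w| + 1.
have Cw : 0 <= C * `|w| by rewrite mulr_ge0// ltW.
have [|||y [_ /eqP + yw]] := @graves F (fun v => A v - w) D 0 r e C C0 e0 eC DC _ 0.
- move=> y z _ _; rewrite opprB addrA subrK -linearB; exact: AD.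
- by rewrite subrr normr0 divr_gt0// /r; lra.
- by rewrite linear0 sub0r normrN /r; lra.
rewrite subr_eq0 => /eqP yE; exists y => //.
by move: yw; rewrite subr0 linear0 sub0r normrN.
Qed.

Lemma onto_bound k (D : {linear E -> 'rV[R]_k}) :
  (forall w, exists v, D v = w) ->
  exists2 C : R, 0 < C & forall w, exists2 v, D v = w & `|v| <= C * `|w|.
Proof.
move=> /linear_section[L DL]; have [C C0 CL] := rV_linear_bounded L.
by exists C => // w; exists (L w).
Qed.

End Graves.

(** * Implicit curves, and tangent spaces as kernels of differentials *)

Section Tangent.
Variables (R : realType) (E : normedVectType R).

Lemma implicit_curve k (h : E -> 'rV[R]_k) (U : set E) (x v : E) :
  open_nbhs x U -> C1_on h U -> (forall w, exists u, 'd h x u = w) ->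
  h x = 0 -> 'd h x v = 0 ->
  exists (I : set R) (c : R -> E),
    [/\ open_nbhs (0 : R) I, @C1_on R R^o E c I,
        forall t, I t -> U (c t) /\ h (c t) = 0, c 0 = x & derive1 c 0 = v].
Proof.
move=> oU hC hS hx hv; set D := 'd h x in hS hv *.
have [L DL] := linear_section hS; have [K K0 LK] := rV_linear_bounded L.
have e0 : 0 < (4 * K)^-1 by rewrite invr_gt0 mulr_gt0.
have [r r0 hr] := C1_on_strict oU hC e0.
have LKe (w : 'rV[R]_k) b : `|w| <= (4 * K)^-1 * b -> `|L w| <= 4^-1 * b.
  move=> wb; apply: le_trans (LK w) _; rewrite -ler_pdivlMl//.
  by apply: le_trans wb _; rewrite invfM mulrA [K^-1 * _]mulrC.
have LB a b : L a - L b = L (a - b) by rewrite linearB.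
have LN a : L (- a) = - L a by rewrite linearN.
(* [phi] has derivative the identity at [x], and [phi y = x + t *: v] forces
   [h y = 0]; so the curve is [c t = phi^-1 (x + t *: v)]. *)
pose phi y := y + L (h y - D (y - x)).
have phiB y z : phi y - phi z = (y - z) + L (h y - h z - D (y - z)).
  rewrite /phi opprD addrACA -linearB; congr (_ + L _).
  by rewrite opprD addrACA -opprD -linearB opprB addrA subrK.
have phiS y z : `|y - x| < r -> `|z - x| < r ->
    `|phi y - phi z - (y - z)| <= 4^-1 * `|y - z|.
  move=> yr zr; rewrite phiB [_ + L _]addrC addrK; apply: LKe.
  by have [_ _] := hr y yr; apply.
have phix : phi x = x by rewrite /phi hx subrr linear0 subrr linear0 addr0.
have v1 : 0 < `|v| + 1 by rewrite ltr_wpDl.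
(* For parameters below [d], the displacement [t *: v] is small enough for Graves' theorem at [x]
   with [D] the identity and [C = 1]. *)
pose d := r / (4 * (`|v| + 1)); have d0 : 0 < d by rewrite divr_gt0 ?mulr_gt0.
have dv t : `|t| < d -> 2 * (`|t| * `|v|) < r / 2.
  rewrite /d ltr_pdivlMr ?mulr_gt0// => td.
  have := mulr_ge0 (normr_ge0 t) (normr_ge0 v); have := normr_ge0 t; nra.
(* Outside the interval the curve takes the default value [0]. *)
have exc t : exists y, `|t| < d -> `|y - x| < r /\ phi y = x + t *: v.
  have [td|_] := boolP (`|t| < d); last by exists 0.
  have [||||y z yr zr|||y [yr /eqP yE _]] :=
    @graves R E E (fun y => phi y - (x + t *: v)) idfun x r 4^-1 1 _ _ _ _ _ x.
  - by [].
  - by rewrite invr_ge0.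
  - by rewrite mulr1.
  - by move=> w; exists w => //; rewrite mul1r.
  - rewrite opprB addrA subrK; exact: phiS.
  - by rewrite subrr normr0 divr_gt0.
  - rewrite phix.
    by rewrite opprD addrA subrr sub0r normrN normrZ mulr1; exact: dv.
  by exists y => _; split => //; apply/eqP; rewrite -subr_eq0.
have [c cP] := choice exc.
have cr t : `|t| < d -> `|c t - x| < r by move=> /cP[].
have cphi t : `|t| < d -> phi (c t) = x + t *: v by move=> /cP[].
have phict s t : `|s| < d -> `|t| < d -> phi (c s) - phi (c t) = (s - t) *: v.
  by move=> sd td; rewrite !cphi// opprD addrACA subrr add0r -scalerBl.
have cU t : `|t| < d -> U (c t) /\ h (c t) = 0.
  move=> td; split; first by have [] := hr _ (cr t td).
  (* Since [L] is a section of [D], applying [D] to [phi y] isolates [h y]; as [D v = 0], the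
     equation [phi (c t) = x + t *: v] then gives [h (c t) = 0]. *)
  have E1 y : D (phi y) = h y + D x.
    rewrite linearD DL linearB opprB addrCA; congr (_ + _).
    by rewrite addrC subrK.
  have Dtv : D (t *: v) = 0 by rewrite linearZ hv; exact: scaler0.
  have := E1 (c t); rewrite cphi// linearD Dtv addr0 => /esym/eqP.
  by rewrite -subr_eq0 addrK => /eqP.
have cLip s t : `|s| < d -> `|t| < d -> `|c s - c t| <= 2 * (`|s - t| * `|v|).
  move=> sd td; have := phiS _ _ (cr s sd) (cr t td); rewrite phict// => H.
  have H1 : `|c s - c t| <= `|(s - t) *: v - (c s - c t)| + `|(s - t) *: v|.
    have := ler_normB ((s - t) *: v) ((s - t) *: v - (c s - c t)).
    by rewrite subKr [leRHS]addrC.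
  have := mulr_ge0 (normr_ge0 (s - t)) (normr_ge0 v).
  move: H1; rewrite normrZ; lra.
(* [A y] is the differential of [phi] at [y]. It stays within [1/4] of the identity, hence is
   invertible, and the velocity [w t] of the curve is the solution of [A (c t) (w t) = v]. *)
pose A y : {linear E -> E} := idfun \+ (L \o ('d h y \- D)).
have AE y u : A y u = u + L ('d h y u - D u) by [].
have AS t u : `|t| < d -> `|A (c t) u - u| <= 4^-1 * `|u|.
  move=> td; rewrite AE [u + _]addrC addrK; apply: LKe.
  by have [_ + _] := hr _ (cr t td); apply.
have Ainj t u : `|t| < d -> `|u| <= 2 * `|A (c t) u|.
  move=> td; have := AS t u td; have : `|u| <= `|A (c t) u - u| + `|A (c t) u|.
    by have := ler_normB (A (c t) u) (A (c t) u - u); rewrite subKr [leRHS]addrC.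
  have := normr_ge0 u; lra.
have exw t : exists w, `|t| < d -> A (c t) w = v.
  have [td|_] := boolP (`|t| < d); last by exists 0.
  have [|||||w Aw _] := @onto_perturb R E E idfun (A (c t)) 4^-1 1 _ _ _ _ _ v.
  - by [].
  - by rewrite invr_ge0.
  - by rewrite mulr1.
  - by move=> w; exists w => //; rewrite mul1r.
  - by move=> u; exact: AS.
  by exists w.
have [w wP] := choice exw.
have w2 t : `|t| < d -> `|w t| <= 2 * `|v|.
  by move=> td; rewrite -(wP t td); exact: Ainj.
have z0 : `|0 : R| < d by rewrite normr0.
have c0 : c 0 = x.
  have := phiS _ _ (cr 0 z0) (_ : `|x - x| < r); rewrite subrr normr0 => /(_ r0).
  rewrite cphi// scale0r addr0 phix subrr sub0r normrN.
  move=> H; apply/eqP; rewrite -subr_eq0 -normr_le0.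
  have := normr_ge0 (c 0 - x); lra.
have w0 : w 0 = v.
  by have := wP 0 z0; rewrite AE c0 subrr linear0 addr0.
have dc t : `|t| < d -> [/\ @differentiable_def R R^o E c _ (Phantom _ (nbhs (t : R^o))),
      (forall s, @diff R R^o E _ (Phantom _ (nbhs (t : R^o))) c s = s *: w t),
      is_derive (t : R^o) 1 c (w t) & derive1 c t = w t].
  move=> td; apply: eps_differentiable1 => e e0'.
  pose e1 := e / (4 * K * (`|v| + 1)).
  (* The factors of [e1] pay for the bound [2] on the inverse of [A], the bound [K] on [L] and the
     Lipschitz constant [2 |v|] of the curve. *)
  have e10 : 0 < e1 by rewrite divr_gt0// !mulr_gt0.
  have [Uct _] := cU t td.
  have [r1 r10 hr1] := differentiable_eps (hC.1 _ Uct) e10.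
  pose r2 := Num.min (d - `|t|) (r1 / (2 * (`|v| + 1))).
  have r20 : 0 < r2 by rewrite lt_min subr_gt0 td divr_gt0// mulr_gt0.
  exists r2 => // s; rewrite lt_min => /andP[st1 st2].
  have sd : `|s| < d.
    rewrite -(subrK t s); apply: le_lt_trans (ler_normD _ _) _.
    by rewrite -ltrBrDr.
  have cst1 := cLip s t sd td.
  have csr1 : `|c s - c t| < r1.
    apply: le_lt_trans cst1 _; move: st2; rewrite ltr_pdivlMr ?mulr_gt0//.
    have := normr_ge0 (s - t); nra.
  have := hr1 _ csr1; set rem := h (c s) - _ - _ => remE.
  have AZ : A (c t) ((s - t) *: w t) = (s - t) *: v by rewrite linearZ wP.
  (* The remainder of the curve is the inverse of [A (c t)] applied to minus [L] of the first-order
     remainder of [h] at [c t]. *)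
  have AL : A (c t) (c s - c t - (s - t) *: w t) = - L rem.
    rewrite linearB AZ -phict// phiB AE opprD addrACA subrr add0r.
    rewrite LB -LN; congr (L _); rewrite /rem.
    by rewrite (opprB _ (D _)) addrA subrK [RHS]opprB.
  have := Ainj t (c s - c t - (s - t) *: w t) td; rewrite AL normrN.
  move=> /le_trans; apply; have H2 := LK rem.
  have H3 : K * `|rem| <= K * (e1 * (2 * (`|s - t| * `|v|))).
    rewrite ler_wpM2l ?(ltW K0)//; apply: le_trans remE _.
    by rewrite ler_wpM2l// ltW.
  have H4 : e1 * (4 * K * (`|v| + 1)) = e by rewrite /e1 divfK// gt_eqF// !mulr_gt0.
  have H5 : 2 * (K * (e1 * (2 * (`|s - t| * `|v|)))) =
     e1 * (4 * K * `|v|) * `|s - t| by ring.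
  have H6 : e1 * (4 * K * `|v|) * `|s - t| <= e * `|s - t|.
    rewrite ler_wpM2r// -[leRHS]H4 ler_wpM2l ?(ltW e10)// ler_wpM2l ?lerDl//.
    by rewrite mulr_ge0// ltW.
  lra.
exists [set t : R | `|t| < d], c; split => //.
- split; last by [].
  rewrite (_ : [set _ | _] = ball (0 : R) d); first exact: ball_open.
  by apply/seteqP; split => t /=; rewrite -ball_normE /ball_ /= sub0r normrN.
- split; first by move=> t td; have [] := dc t td.
  move=> t td e e0'.
  pose e1 := e / (4 * K * (`|v| + 1)).
  have e10 : 0 < e1 by rewrite divr_gt0// !mulr_gt0.
  have [Uct _] := cU t td.
  have [r1 r10 hr1] := nbhs_ball_ex (hC.2 _ Uct e1 e10).
  pose r2 := Num.min (d - `|t|) (r1 / (2 * (`|v| + 1))).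
  have r20 : 0 < r2 by rewrite lt_min subr_gt0 td divr_gt0// mulr_gt0.
  apply: (ball_nbhs_ex r20) => s; rewrite lt_min => /andP[st1 st2] a.
  have sd : `|s| < d.
    rewrite -(subrK t s); apply: le_lt_trans (ler_normD _ _) _.
    by rewrite -ltrBrDr.
  have csr1 : `|c s - c t| < r1.
    apply: le_lt_trans (cLip s t sd td) _; move: st2; rewrite ltr_pdivlMr ?mulr_gt0//.
    have := normr_ge0 (s - t); nra.
  have [_ -> _ _] := dc s sd; have [_ -> _ _] := dc t td.
  rewrite -scalerBr normrZ mulrC ler_wpM2r//.
  (* Subtracting the equations for [w s] and [w t] reduces continuity of the velocity to that of the
     differential of [h]. *)
  have AL : A (c s) (w s - w t) = - L ('d h (c s) (w t) - 'd h (c t) (w t)).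
    rewrite linearB wP// -(wP t td) !AE opprD addrACA subrr add0r.
    by rewrite LB -LN; congr (L _); rewrite !opprB addrA subrK.
  have := Ainj s (w s - w t) sd; rewrite AL normrN => /le_trans; apply.
  have H1 := hr1 _ csr1 (w t).
  have H2 := LK ('d h (c s) (w t) - 'd h (c t) (w t)).
  have H3 : K * `|'d h (c s) (w t) - 'd h (c t) (w t)| <= K * (e1 * (2 * `|v|)).
    rewrite ler_wpM2l ?(ltW K0)//; apply: le_trans H1 _.
    by rewrite ler_wpM2l ?(ltW e10)// w2.
  have H4 : e1 * (4 * K * (`|v| + 1)) = e by rewrite /e1 divfK// gt_eqF// !mulr_gt0.
  have H5 : 2 * (K * (e1 * (2 * `|v|))) = e1 * (4 * K * `|v|) by ring.
  have H6 : e1 * (4 * K * `|v|) <= e.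
    rewrite -[leRHS]H4 ler_wpM2l ?(ltW e10)// ler_wpM2l ?lerDl//.
    by rewrite mulr_ge0// ltW.
  lra.
- by have [_ _ _ ->] := dc 0 z0.
Qed.

Lemma ker_tangent k (S : set E) (h : E -> 'rV[R]_k) (U : set E) (x v : E) :
  open_nbhs x U -> C1_on h U -> (forall w, exists u, 'd h x u = w) ->
  (forall y, U y -> h y = 0 -> S y) -> h x = 0 -> 'd h x v = 0 ->
  tangent S x v.
Proof.
move=> oU hC hS US hx hv.
have [I [c [oI cC cU c0 c0v]]] := implicit_curve oU hC hS hx hv.
by exists I, c; split => // t /cU[]; exact: US.
Qed.

Lemma tangent_approx (S : set E) (x v : E) (e : R) :
  tangent S x v -> 0 < e ->
  exists2 r : R, 0 < r & forall t, `|t| < r ->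
    exists2 y, S y & `|y - x - t *: v| <= e * `|t|.
Proof.
move=> [I [c [oI [cd _] cS c0 c0v]]] e0.
have [r1 r10 rI] := nbhs_ball_ex (open_nbhs_nbhs oI).
have cd0 := cd 0 oI.2.
have [r2 r20 rc] := differentiable_eps cd0 e0.
have r0 : 0 < Num.min r1 r2 by rewrite lt_min r10.
exists (Num.min r1 r2) => // t; rewrite lt_min => /andP[t1 t2].
exists (c t); first by apply/cS/rI; rewrite subr0.
have := rc t; rewrite subr0 => /(_ t2); rewrite c0.
suff -> : @diff R R^o E _ (Phantom _ (nbhs (0 : R^o))) c t = t *: v by [].
by rewrite -c0v; exact: (congr1 (fun g : R -> E => g t) (diff1E cd0)).
Qed.

(** Points [x + t *: v + o(t)] of [S] are zeros of [h], whereas strict differentiability gives [h]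
    the value [t *: D v + o(t)] there. *)
Lemma tangent_ker k (S : set E) (h : E -> 'rV[R]_k) (U : set E) (x v : E) :
  open_nbhs x U -> C1_on h U -> (forall y, S y -> U y -> h y = 0) -> S x ->
  tangent S x v -> 'd h x v = 0.
Proof.
move=> oU hC SU Sx Tv; set D := 'd h x.
apply/eqP; rewrite -normr_le0 leNgt; apply/negP => a0.
have [K K0 DK] := linear_bounded D.
have B0 : 0 < 2 * (`|v| + 1 + K) by rewrite mulr_gt0// addr_gt0// ltr_wpDl.
(* All errors add up to [e (|v| + 1 + K)] per unit of [t], at most half the norm of [D v]. *)
pose e := Num.min 1 (`|D v| / (2 * (`|v| + 1 + K))).
have e0 : 0 < e by rewrite lt_min ltr01 divr_gt0.
have e1 : e <= 1 by rewrite ge_min lexx.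
have eD : e * (2 * (`|v| + 1 + K)) <= `|D v|.
  by rewrite -ler_pdivlMr// ge_min lexx orbT.
have [r1 r10 hr1] := C1_on_strict oU hC e0.
have [r2 r20 hr2] := tangent_approx Tv e0.
have v1 : 0 < `|v| + 1 by rewrite ltr_wpDl.
pose t := Num.min r2 (r1 / (`|v| + 1)) / 2.
have m0 : 0 < Num.min r2 (r1 / (`|v| + 1)) by rewrite lt_min r20 divr_gt0.
have t0 : 0 < t by rewrite divr_gt0.
have tm : t < Num.min r2 (r1 / (`|v| + 1)) by rewrite /t; lra.
move: tm; rewrite lt_min => /andP[tr2 tr1].
have [|y Sy yt] := hr2 t; first by rewrite gtr0_norm.
rewrite gtr0_norm// in yt.
have yx : `|y - x| <= t * (`|v| + 1).
  rewrite -(subrK (t *: v) (y - x)); apply: le_trans (ler_normD _ _) _.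
  rewrite normrZ gtr0_norm//; nra.
have yr1 : `|y - x| < r1 by apply: le_lt_trans yx _; rewrite -ltr_pdivlMr.
have xr1 : `|x - x| < r1 by rewrite subrr normr0.
have [Uy _ /(_ x xr1)] := hr1 y yr1.
have [Ux _ _] := hr1 x xr1.
rewrite (SU y)// (SU x)// subrr sub0r normrN => H1.
have H2 : t * `|D v| <= `|D (y - x)| + K * `|y - x - t *: v|.
  have -> : t * `|D v| = `|D (t *: v)| by rewrite linearZ normrZ gtr0_norm.
  rewrite -[t *: v in X in X <= _](subKr (y - x)) linearB.
  by apply: le_trans (ler_normB _ _) _; rewrite lerD2l.
have H3 : K * `|y - x - t *: v| <= K * (e * t) by rewrite ler_wpM2l// ltW.
have H4 : e * `|y - x| <= e * (t * (`|v| + 1)) by rewrite ler_wpM2l// ltW.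
have H5 : t * `|D v| <= t * (e * (`|v| + 1 + K)).
  have -> : t * (e * (`|v| + 1 + K)) = e * (t * (`|v| + 1)) + K * (e * t) by ring.
  lra.
by move: H5; rewrite ler_pM2l// => H5; lra.
Qed.

End Tangent.

(** * Nearest points and normal vectors *)

Section Proximal.
Variables (R : realType) (E : normedVectType R).

(** Continuity is given only at points of the ball, so closedness is checked pointwise: near a
    closure point [y] with [h y] nonzero, continuity excludes zeros of [h]. *)
Lemma zero_locus_compact (F : normedModType R) (h : E -> F) (z : E) (r : R) :
  (forall y, `|y - z| <= r -> {for y, continuous h}) ->
  compact [set y | `|y - z| <= r /\ h y = 0].
Proof.
move=> hc; apply: (subclosed_compact _ (@closed_ball_fd_compact _ _ z r)); last first.
  by move=> y [].
move=> y cy; have yz : `|y - z| <= r.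
  apply: (@closed_ball_norm_closed _ _ z r) => B /cy[w [[? _] Bw]].
  by exists w.
split => //; apply/eqP; rewrite -normr_le0 leNgt; apply/negP => hy0.
have [w [[_ hw] /=]] := cy _ ((cvgrPdist_lt _ _).1 (hc y yz) _ hy0).
by rewrite hw subr0 ltxx.
Qed.

(** A minimiser over the compact piece is global: points of [M] beyond radius [r] are farther from
    [s] than [z] is. *)
Lemma nearest_point (M : set E) (z s : E) (r : R) :
  M z -> compact (M `&` [set y | `|y - z| <= r]) -> `|s - z| < r / 2 ->
  exists m, [/\ M m, forall y, M y -> `|s - m| <= `|s - y| &
                 `|m - z| <= 2 * `|s - z|].
Proof.
move=> Mz cM sz.
have zr : `|z - z| <= r by rewrite subrr normr0; have := normr_ge0 (s - z); lra.
have [||m [Mm mr] mmin] := @lipschitz_min R E _ (fun y => `|s - y|) 1 _ cM.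
- by exists z.
- move=> x y _ _; apply: le_trans (ler_dist_dist _ _) _.
  by rewrite opprB addrC subrKA mul1r distrC.
have ms := mmin z (conj Mz zr).
exists m; split => // [y My|].
  have [yr|yr] := leP `|y - z| r; first exact: mmin.
  have : `|y - z| <= `|s - y| + `|s - z|.
    by rewrite (distrC s y) -[y - z](subrKA s) ler_normD.
  by lra.
have : `|m - z| <= `|s - m| + `|s - z|.
  by rewrite (distrC s m) -[m - z](subrKA s) ler_normD.
by lra.
Qed.

Variables (dot : {dot E for idfun}) (hdot : euclidean dot).

Lemma dotC x y : dot x y = dot y x.
Proof. by rewrite hermC expr0 mul1r. Qed.

Lemma sqnormD x y : `|x + y| ^+ 2 = `|x| ^+ 2 + 2 * dot x y + `|y| ^+ 2.
Proof.
by rewrite !hdot linearDl !linearDr /= (dotC y x); ring.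
Qed.

Lemma dot_le x y : dot x y <= `|x| * `|y|.
Proof.
have := sqnormD x y; have := ler_normD x y.
have := normr_ge0 (x + y); have := normr_ge0 x; have := normr_ge0 y; nra.
Qed.

(** The orthogonal projection, found as a nearest point of the kernel; minimality along the lines
    [p + t *: v] gives orthogonality. *)
Lemma ker_projection k (D : {linear E -> 'rV[R]_k}) (u : E) :
  exists2 p, D p = 0 & forall v, D v = 0 -> dot (u - p) v = 0.
Proof.
have D0 : [set y | D y = 0] 0 by rewrite /= linear0.
have [||p [Dp pmin _]] := @nearest_point _ 0 u (2 * `|u| + 1) D0.
- rewrite setIC; apply: zero_locus_compact => y _.
  exact: linear_continuous_fd.
- by rewrite subr0; lra.
exists p => // v Dv; set b := dot (u - p) v.
have H t : 2 * t * b <= t ^+ 2 * `|v| ^+ 2.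
  have /= := pmin (p + t *: v); rewrite linearD linearZ Dp Dv /=.
  rewrite (_ : 0 + _ = 0); last by rewrite add0r; exact: scaler0.
  move=> /(_ erefl) up.
  have : `|u - p| ^+ 2 <= `|u - (p + t *: v)| ^+ 2 by rewrite ler_sqr ?nnegrE.
  rewrite opprD addrA (sqnormD (u - p)) linearNr linearZr /= -/b normrN normrZ exprMn.
  rewrite real_normK ?num_real//; lra.
(* Almost the optimal step; the [+ 1] covers [v = 0]. *)
have := H (b / (`|v| ^+ 2 + 1)).
have q0 := sqr_ge0 `|v|; set q := `|v| ^+ 2 in q0 *.
have q1 : 0 < q + 1 by lra.
set t := b / (q + 1) => H1; have bt : b = t * (q + 1) by rewrite /t divfK// gt_eqF.
have : t ^+ 2 * (q + 2) <= 0 by move: H1; rewrite {1}bt; nra.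
have := sqr_ge0 t => t2 t3.
have : t ^+ 2 <= 0 by nra.
rewrite real_exprn_even_le0 ?num_real//= => /eqP t0.
by rewrite bt t0 mul0r.
Qed.

(* The first-order optimality condition: if [x] minimises [|z - y| + s |z - x|] over
   [S] locally, then the projection of [(x - y)/|x - y|] on the tangent space has
   norm at most [s]. *)
Lemma normal_slope k (S : set E) (h : E -> 'rV[R]_k) (U : set E) (x y : E)
    (s r : R) :
  open_nbhs x U -> C1_on h U -> (forall w, exists u, 'd h x u = w) ->
  S `&` U = [set y | U y /\ h y = 0] -> S x -> x != y -> 0 <= s -> 0 < r ->
  (forall z, S z -> `|z - x| < r -> `|x - y| <= `|z - y| + s * `|z - x|) ->
  exists2 w, normal dot S x w & `|(`|x - y|^-1 *: (x - y)) - w| <= s.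
Proof.
move=> oU hC hS SU Sx xy s0 r0 slope.
have SUE z : S z -> U z -> h z = 0.
  by move=> Sz Uz; have : (S `&` U) z by []; rewrite SU => -[].
have USE z : U z -> h z = 0 -> S z.
  move=> Uz hz; have : [set y | U y /\ h y = 0] z by [].
  by rewrite -SU => -[].
set a := `|x - y|; have a0 : 0 < a by rewrite normr_gt0 subr_eq0.
set u := a^-1 *: (x - y).
have [p Dp pP] := ker_projection ('d h x) u.
exists (u - p); first by move=> v /(tangent_ker oU hC SUE Sx); exact: pP.
rewrite subKr leNgt; apply/negP => sp.
have up : dot u p = `|p| ^+ 2.
  by apply/eqP; rewrite -subr_eq0 hdot -linearBl; apply/eqP/pP.
have xyp : dot (x - y) p = a * `|p| ^+ 2.
  have -> : x - y = a *: u by rewrite scalerA divff ?scale1r// gt_eqF.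
  by rewrite linearZl /= up.
have Tp : tangent S x (- p).
  apply: (ker_tangent oU hC hS USE); first exact: SUE oU.2.
  by rewrite linearN Dp oppr0.
set P := `|p| in sp up xyp *.
have P0 : 0 < P by exact: le_lt_trans sp.
(* Moving by [- t *: p] brings [x] closer to [y] by about [t P^2] and costs [s t P]. With this
   [eta], the tangent approximation error consumes half of the gain [P^2 - s P]. *)
pose eta := (P ^+ 2 - s * P) / (2 * (1 + s)).
have s1 : 0 < 2 * (1 + s) by lra.
have PP : 0 < P ^+ 2 - s * P by nra.
have eta0 : 0 < eta by rewrite divr_gt0.
have etaE : eta * (2 * (1 + s)) = P ^+ 2 - s * P by rewrite divfK// gt_eqF.
have [r1 r10 r1P] := tangent_approx Tp eta0.
pose b := eta + s * (P + eta).
have b0 : 0 < b by rewrite ltr_wpDr// mulr_ge0// addr_ge0 ?ltW.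
have bE : 2 * b = P ^+ 2 + s * P by rewrite /b; lra.
(* In order: the approximation is valid, [z] stays in the [r]-ball, [a - t b] is positive so that
   squaring is allowed, and the quadratic term [t P^2] does not eat the remaining gain. *)
pose m := Num.min (Num.min r1 (r / (P + eta))) (Num.min (a / b) (a * (P ^+ 2 - s * P) / P ^+ 2)).
have m0 : 0 < m.
  rewrite !lt_min r10 !divr_gt0 ?mulr_gt0 ?exprn_gt0//.
  exact: addr_gt0.
pose t := m / 2; have t0 : 0 < t by rewrite divr_gt0.
have : t < m by rewrite /t; lra.
rewrite !lt_min => /andP[/andP[t1 t2] /andP[t3 t4]].
have [|z Sz] := r1P t; first by rewrite gtr0_norm.
rewrite gtr0_norm// scalerN opprK => zt.
have zx : `|z - x| <= t * (P + eta).
  rewrite -[z - x](addrK (t *: p)); apply: le_trans (ler_normB _ _) _.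
  rewrite normrZ gtr0_norm// -/P; lra.
have zr : `|z - x| < r.
  apply: le_lt_trans zx _; rewrite -ltr_pdivlMr//; exact: addr_gt0.
have zy : `|z - y| <= eta * t + `|x - y - t *: p|.
  have -> : z - y = (z - x + t *: p) + (x - y - t *: p).
    by rewrite addrACA subrr addr0 subrKA.
  by apply: le_trans (ler_normD _ _) _; rewrite lerD2r.
have := slope z Sz zr; rewrite -/a => H1.
have H2 : s * `|z - x| <= s * (t * (P + eta)) by rewrite ler_wpM2l.
have H3 : a - t * b <= `|x - y - t *: p| by rewrite /b; lra.
have tba : t * b < a by rewrite -ltr_pdivlMr.
have tP : t * P ^+ 2 < a * (P ^+ 2 - s * P) by rewrite -ltr_pdivlMr// exprn_gt0.
have H4 : (a - t * b) ^+ 2 <= `|x - y - t *: p| ^+ 2.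
  by rewrite ler_sqr ?nnegrE//; lra.
move: H4; rewrite sqnormD linearNr linearZr /= xyp normrN normrZ gtr0_norm//.
rewrite -/a -/P exprMn => H4.
have H5 : t * (2 * (a * P ^+ 2)) <= t * (2 * (a * b) + t * P ^+ 2).
  by have := sqr_ge0 (t * b); nra.
move: H5; rewrite ler_pM2l// => H5.
have H6 : 2 * (a * b) = a * (P ^+ 2 + s * P) by rewrite -bE; ring.
suff : (0 : R) < 0 by rewrite ltxx.
lra.
Qed.

Lemma dist_le (A : set E) (y w : E) (b : R) : A w -> `|y - w| <= b -> dist y A <= b.
Proof.
move=> Aw yw; apply: le_trans yw; apply: ge_inf; last by exists w => //; rewrite distrC.
by exists 0 => _ [x _ <-].
Qed.

Lemma dist_lt (A : set E) (y : E) (b : R) : A !=set0 -> dist y A < b ->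
  exists2 w, A w & `|y - w| < b.
Proof.
move=> [a Aa] /inf_lt[|_ [w Aw <-] wb].
  by exists `|a - y|, a.
by exists w => //; rewrite distrC.
Qed.

Lemma normal0 (S : set E) x : normal dot S x 0.
Proof. by move=> v _; rewrite linear0l. Qed.

Lemma normalN (S : set E) x w : normal dot S x w -> normal dot S x (- w).
Proof. by move=> Nw v /Nw; rewrite linearNl /= => ->; rewrite oppr0. Qed.

End Proximal.

(** * Local regularity of a submanifold *)

Section LocalModel.
Variables (R : realType) (E : normedVectType R).

Lemma C1_on_subset (F : normedModType R) (h : E -> F) (U V : set E) :
  V `<=` U -> C1_on h U -> C1_on h V.
Proof. by move=> VU [hd hC]; split => x /VU; [exact: hd | exact: hC]. Qed.

Lemma norm_row_mx_le a b (x : 'rV[R]_a) (y : 'rV[R]_b) :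
  `|row_mx x y| <= `|x| + `|y|.
Proof.
apply: norm_rV_le => [|i]; first exact: addr_ge0.
rewrite mxE; case: (fintype.split i) => j; apply: le_trans (coord_le_norm _ j) _.
- by rewrite lerDl.
- by rewrite lerDr.
Qed.

Definition row_map a b (D1 : E -> 'rV[R]_a) (D2 : E -> 'rV[R]_b) v :=
  row_mx (D1 v) (D2 v).

Fact row_map_linear a b (D1 : {linear E -> 'rV[R]_a}) (D2 : {linear E -> 'rV[R]_b}) :
  linear (row_map D1 D2).
Proof.
by move=> t u v; rewrite /row_map !linearP /= scale_row_mx add_row_mx.
Qed.

HB.instance Definition _ a b (D1 : {linear E -> 'rV[R]_a})
    (D2 : {linear E -> 'rV[R]_b}) :=
  GRing.isLinear.Build _ _ _ _ (row_map D1 D2) (row_map_linear D1 D2).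

(** The kernel of the paired map [row_map A B] lies in that of [C], so [C] factors through it by a
    bounded linear map. *)
Lemma linear_dominated a b c (A : {linear E -> 'rV[R]_a})
    (B : {linear E -> 'rV[R]_b}) (C : {linear E -> 'rV[R]_c}) :
  (forall v, A v = 0 -> B v = 0 -> C v = 0) ->
  exists2 Q : R, 0 < Q & forall v, `|C v| <= Q * (`|A v| + `|B v|).
Proof.
move=> ABC; have [|G GE] := @linear_factor R E _ _ (row_map A B) C.
  move=> v; rewrite /row_map -(row_mx0 _ _ a b) => /eq_row_mx[Av Bv].
  exact: ABC.
have [K K0 GK] := rV_linear_bounded G.
exists K => // v; rewrite GE; apply: le_trans (GK _) _.
by rewrite ler_wpM2l ?(ltW K0)//; exact: norm_row_mx_le.
Qed.

Variables (S : set E) (k : nat) (h : E -> 'rV[R]_k) (U : set E) (z : E).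
Hypotheses (oU : open_nbhs z U) (hC : C1_on h U)
  (SU : S `&` U = [set y | U y /\ h y = 0])
  (hS : forall w, exists v, 'd h z v = w) (Sz : S z).

Lemma modelP y : U y -> S y <-> h y = 0.
Proof.
move=> Uy; split => [Sy|hy].
  by have : (S `&` U) y by []; rewrite SU => -[].
by have : [set y | U y /\ h y = 0] y by []; rewrite -SU => -[].
Qed.

Lemma model0 : h z = 0. Proof. by apply/(modelP oU.2). Qed.

Lemma secant_ker (e : R) : 0 < e ->
  exists2 r : R, 0 < r & forall x y, S x -> S y -> `|x - z| < r -> `|y - z| < r ->
    `|'d h z (x - y)| <= e * `|x - y|.
Proof.
move=> e0; have [r r0 hr] := C1_on_strict oU hC e0.
exists r => // x y Sx Sy xr yr.
have [Ux _ /(_ y yr)] := hr x xr; have [Uy _ _] := hr y yr.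
by rewrite (modelP Ux).1// (modelP Uy).1// subrr sub0r normrN.
Qed.

Lemma near_onto :
  exists2 r : R, 0 < r & forall x, `|x - z| < r ->
    forall w, exists v, 'd h x v = w.
Proof.
have [C C0 DC] := onto_bound hS.
have e0 : 0 < (4 * C)^-1 by rewrite invr_gt0 mulr_gt0.
have eC : (4 * C)^-1 * C <= 4^-1 by rewrite invfM -mulrA mulVf ?mulr1// gt_eqF.
have [r r0 hr] := C1_on_strict oU hC e0.
exists r => // x xr w; have [_ dx _] := hr x xr.
by have [v vw _] := onto_perturb C0 (ltW e0) eC DC dx w; exists v.
Qed.

(** The differential at [x] almost kills [x - y]; subtracting a small preimage [u] of that value
    lands in its kernel, the tangent space. The bound on preimages is uniform for [x] near [z]. *)
Lemma secant_tangent (e : R) : 0 < e ->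
  exists2 r : R, 0 < r & forall x y, S x -> S y -> `|x - z| < r -> `|y - z| < r ->
    exists2 v, tangent S x v & `|x - y - v| <= e * `|x - y|.
Proof.
move=> e0; have [C C0 DC] := onto_bound hS.
pose e1 := Num.min (e / (4 * C)) (4 * C)^-1.
have e10 : 0 < e1 by rewrite lt_min divr_gt0 ?mulr_gt0// invr_gt0 mulr_gt0.
have e1C : e1 * C <= 4^-1.
  by rewrite -ler_pdivlMr// -invfM ge_min lexx orbT.
have e1e : e1 * (4 * C) <= e by rewrite -ler_pdivlMr ?mulr_gt0// ge_min lexx.
have [r r0 hr] := C1_on_strict oU hC e10.
exists r => // x y Sx Sy xr yr.
have [Ux dx /(_ y yr)] := hr x xr; have [Uy _ _] := hr y yr.
rewrite (modelP Ux).1// (modelP Uy).1// subrr sub0r normrN => H1.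
have onto_x := onto_perturb C0 (ltW e10) e1C DC dx.
have [u uE uC] := onto_x ('d h x (x - y)).
exists (x - y - u).
  apply: (@ker_tangent _ _ _ S h U).
  - by split => //; exact: oU.1.
  - exact: hC.
  - by move=> w; have [v vw _] := onto_x w; exists v.
  - by move=> t Ut; exact: (modelP Ut).2.
  - exact: (modelP Ux).1.
  - by rewrite linearB uE subrr.
rewrite subKr; apply: le_trans uC _.
have H2 : `|'d h x (x - y)| <= 2 * (e1 * `|x - y|).
  have := dx (x - y); have := ler_normD ('d h x (x - y) - 'd h z (x - y)) ('d h z (x - y)).
  by rewrite subrK; lra.
have H3 : 2 * C * `|'d h x (x - y)| <= 2 * C * (2 * (e1 * `|x - y|)).
  by rewrite ler_wpM2l// mulr_ge0// ltW.
apply: le_trans H3 _.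
have -> : 2 * C * (2 * (e1 * `|x - y|)) = e1 * (4 * C) * `|x - y| by ring.
by rewrite ler_wpM2r.
Qed.

Lemma metric_regularity :
  exists C r : R, [/\ 0 < C, 0 < r & forall s, `|s - z| < r ->
    exists y, [/\ U y, h y = 0 & `|y - s| <= C * `|h s|]].
Proof.
have [C C0 DC] := onto_bound hS.
have e0 : 0 < (4 * C)^-1 by rewrite invr_gt0 mulr_gt0.
have eC : (4 * C)^-1 * C <= 4^-1 by rewrite invfM -mulrA mulVf ?mulr1// gt_eqF.
have [r r0 hr] := C1_on_strict oU hC e0.
have hrr y w : `|y - z| < r -> `|w - z| < r ->
    `|h y - h w - 'd h z (y - w)| <= (4 * C)^-1 * `|y - w|.
  by move=> yr wr; have [_ _] := hr y yr; apply.
have [K K0 DK] := linear_bounded ('d h z).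
have B0 : 0 < 2 * C * (K + (4 * C)^-1) by rewrite !mulr_gt0// addr_gt0.
(* Near [z] the norm of [h s] is at most [K + (4 C)^-1] times the distance from [s] to [z], so this
   radius meets the smallness condition of Graves' theorem. *)
pose r1 := Num.min (r / 2) (r / 2 / (2 * C * (K + (4 * C)^-1))).
exists (2 * C), r1; split.
- by rewrite mulr_gt0.
- by rewrite lt_min !divr_gt0.
move=> s; rewrite lt_min => /andP[s1 s2].
have zr : `|z - z| < r by rewrite subrr normr0.
have sr : `|s - z| < r by lra.
have hs : `|h s| <= (K + (4 * C)^-1) * `|s - z|.
  have := hrr s z sr zr; rewrite model0 subr0 => H.
  have := DK (s - z); have := ler_normD (h s - 'd h z (s - z)) ('d h z (s - z)).
  by rewrite subrK; lra.
have [|y [yr hy ys]] := graves C0 (ltW e0) eC DC hrr s1.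
  move: s2; rewrite ltr_pdivlMr//; apply: le_lt_trans.
  by rewrite [leRHS]mulrC -[leRHS]mulrA ler_wpM2l// mulr_ge0// ltW.
by exists y; split => //; have [] := hr y yr.
Qed.

Lemma model_compact :
  exists2 r : R, 0 < r & compact (S `&` [set y | `|y - z| <= r]).
Proof.
have [r r0 rU] := nbhs_ball_ex (open_nbhs_nbhs oU).
have rU2 y : `|y - z| <= r / 2 -> U y by move=> yr; apply: rU; lra.
exists (r / 2); first exact: divr_gt0.
rewrite (_ : _ `&` _ = [set y | `|y - z| <= r / 2 /\ h y = 0]).
  apply: zero_locus_compact => y /rU2 Uy.
  exact/differentiable_continuous/hC.1.
apply/seteqP; split => y /= [].
  by move=> Sy yr; split => //; exact/(modelP (rU2 _ yr)).
by move=> yr hy; split => //; exact/(modelP (rU2 _ yr)).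
Qed.

(** For [y] nearest to [x], metric regularity bounds the distance by [C] times the norm of [h x],
    and [h x] differs from ['d h z (x - y)] by a term small enough to absorb on the left. *)
Lemma nearest_secant :
  exists C r : R, [/\ 0 < C, 0 < r & forall x, `|x - z| < r ->
    exists y, [/\ S y, `|y - z| <= 2 * `|x - z| & `|x - y| <= C * `|'d h z (x - y)|]].
Proof.
have [C [r1 [C0 r10 reg]]] := metric_regularity.
have e0 : 0 < (2 * C)^-1 by rewrite invr_gt0 mulr_gt0.
have [r2 r20 hr] := C1_on_strict oU hC e0.
have [r3 r30 cS] := model_compact.
pose r := Num.min r1 (Num.min (r2 / 2) (r3 / 2)).
have r0 : 0 < r by rewrite !lt_min r10 !divr_gt0.
exists (2 * C), r; split => //; first by rewrite mulr_gt0.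
move=> x; rewrite !lt_min => /and3P[x1 x2 x3].
have [y [Sy ymin yz]] := nearest_point Sz cS x3.
exists y; split => //.
have [m [Um hm mx]] := reg x x1.
have := ymin m ((modelP Um).2 hm); rewrite (distrC x m) => H1.
have yr2 : `|y - z| < r2 by lra.
have xr2 : `|x - z| < r2 by have := normr_ge0 (x - z); lra.
have [Uy _ _] := hr y yr2; have [_ _ /(_ y yr2)] := hr x xr2.
rewrite (modelP Uy).1// subr0 => H2.
have H3 : `|h x| <= (2 * C)^-1 * `|x - y| + `|'d h z (x - y)|.
  have := ler_normD (h x - 'd h z (x - y)) ('d h z (x - y)).
  by rewrite subrK; lra.
have H4 : C * `|h x| <= C * ((2 * C)^-1 * `|x - y| + `|'d h z (x - y)|).
  by rewrite ler_wpM2l// ltW.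
have H5 : C * (2 * C)^-1 = 2^-1 by rewrite invfM mulrCA mulfV ?mulr1// gt_eqF.
rewrite mulrDr mulrA H5 in H4; lra.
Qed.

End LocalModel.

(** * Clean intersection implies transversality *)

Section CleanToTransversal.
Variables (R : realType) (E : normedVectType R) (dot : {dot E for idfun}).
Hypothesis hdot : euclidean dot.
Variables (X Y : set E).
Hypotheses (hX : C1_embedded_submanifold X) (hY : C1_embedded_submanifold Y).
Variable Z : E.
Hypothesis hZ : (X `&` Y) Z.

Lemma clean_regularity : intersect_cleanly X Y Z ->
  exists P r : R, [/\ 0 < P, 0 < r & forall x y, X x -> Y y ->
    `|x - Z| < r -> `|y - Z| < r ->
    exists z, [/\ X z, Y z, `|z - Z| <= 2 * `|x - Z|,
      `|x - z| <= P * `|x - y| & `|y - z| <= (P + 1) * `|x - y|]].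
Proof.
case: hZ => XZ YZ [B [oB [k hM] tanM]].
have BZ : B Z := oB.2.
have [k1 /(_ Z XZ)[UX [fX [oUX CX SUX ontoX]]]] := hX.
have [k2 /(_ Z YZ)[UY [fY [oUY CY SUY ontoY]]]] := hY.
have MZ : (X `&` Y `&` B) Z by [].
have [UM [fM [oUM CM SUM ontoM]]] := hM Z MZ.
(* Here cleanness enters: a vector in both kernels is tangent to [X] and [Y], hence to their
   intersection. As [fM] describes only the part of it inside [B], its domain is cut down to [UM]
   within [B]. *)
have kerM v : 'd fX Z v = 0 -> 'd fY Z v = 0 -> 'd fM Z v = 0.
  move=> vX vY; have : tangent (X `&` Y) Z v.
    rewrite tanM//; split.
      apply: (ker_tangent oUX CX ontoX) vX; first by move=> y /(modelP SUX)[].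
      exact: model0 oUX SUX XZ.
    apply: (ker_tangent oUY CY ontoY) vY; first by move=> y /(modelP SUY)[].
    exact: model0 oUY SUY YZ.
  apply: (@tangent_ker _ _ _ _ fM (UM `&` B)) => //.
  - split; last by split; [exact: oUM.2|].
    by apply: openI; [exact: oUM.1 | exact: oB.1].
  - by apply: C1_on_subset CM => y [].
  - by move=> y XYy [Uy By]; apply/(modelP SUM Uy).
have [Q Q0 QM] := linear_dominated kerM.
have [C [r1 [C0 r10 near1]]] := nearest_secant oUM CM SUM ontoM MZ.
have [K K0 KY] := linear_bounded ('d fY Z).
(* Makes [2 C Q e = 1/2], so the terms in [x - z] are absorbed. *)
pose e := (4 * (C * Q))^-1.
have CQ : 0 < C * Q by rewrite mulr_gt0.
have e0 : 0 < e by rewrite invr_gt0 mulr_gt0.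
have eE : C * Q * e = 4^-1 by rewrite /e invfM mulrCA mulfV ?mulr1// gt_eqF.
have [rx rx0 secX] := secant_ker oUX CX SUX e0.
have [ry ry0 secY] := secant_ker oUY CY SUY e0.
pose r := Num.min r1 (Num.min (rx / 2) (ry / 2)).
exists (2 * (C * Q) * (e + K)), r; split.
- by rewrite !mulr_gt0// addr_gt0.
- by rewrite !lt_min r10 !divr_gt0.
move=> x y Xx Yy; rewrite !lt_min => /and3P[x1 xx xy] /and3P[y1 yx yy].
have [z [[[Xz Yz] Bz] zZ xz]] := near1 x x1.
have x0 := normr_ge0 (x - Z); have y0 := normr_ge0 (y - Z).
have HX : `|'d fX Z (x - z)| <= e * `|x - z| by apply: secX => //; lra.
have HY : `|'d fY Z (y - z)| <= e * `|y - z| by apply: secY => //; lra.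
have xyz : x - z = (x - y) + (y - z) by rewrite subrKA.
(* [x - z] is not a secant of [Y], so the estimate passes through [y]. *)
have HY2 : `|'d fY Z (x - z)| <= K * `|x - y| + e * `|y - z|.
  rewrite xyz linearD; apply: le_trans (ler_normD _ _) _.
  exact: lerD.
have yzx : `|y - z| <= `|x - y| + `|x - z|.
  by rewrite distrC [`|x - z|]distrC [leRHS]addrC -[z - y](subrKA x) ler_normD.
have e1 : e * `|y - z| <= e * (`|x - y| + `|x - z|) by rewrite ler_wpM2l// ltW.
have H1 : C * `|'d fM Z (x - z)| <= C * (Q * (2 * (e * `|x - z|) + (e + K) * `|x - y|)).
  rewrite ler_wpM2l ?(ltW C0)//; apply: le_trans (QM _) _.
  rewrite ler_wpM2l ?(ltW Q0)//; lra.
have H2 : C * (Q * (2 * (e * `|x - z|) + (e + K) * `|x - y|)) =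
  2 * (C * Q * e) * `|x - z| + C * Q * (e + K) * `|x - y| by ring.
have xzP : `|x - z| <= 2 * (C * Q) * (e + K) * `|x - y|.
  move: H1; rewrite H2 eE => H1.
  have -> : 2 * (C * Q) * (e + K) * `|x - y| = 2 * (C * Q * (e + K) * `|x - y|).
    by ring.
  lra.
by exists z; split => //; rewrite mulrDl mul1r; lra.
Qed.

(** Since [w] is orthogonal to [v], the product of [u] and [d] splits as that of [u - w] with [d]
    plus that of [w] with [d - v]; moreover [w] has norm at most [2]. *)
Lemma dot_near_normal (S : set E) (x u w d v : E) (kappa e : R) :
  normal dot S x w -> tangent S x v -> `|u - w| <= kappa -> `|u| <= 1 ->
  kappa <= 1 -> 0 <= e -> `|d - v| <= e * `|d| ->
  dot u d <= (kappa + 2 * e) * `|d|.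
Proof.
move=> Nw Tv uw u1 k1 e0 dv.
have -> : dot u d = dot (u - w) d + dot w (d - v).
  by rewrite linearBl linearBr /= (Nw v Tv) subr0 subrK.
have H1 := dot_le hdot (u - w) d; have H2 := dot_le hdot w (d - v).
have w2 : `|w| <= 2.
  have := ler_normB u (u - w); rewrite subKr; lra.
have H3 : `|u - w| * `|d| <= kappa * `|d| by rewrite ler_wpM2r.
have H4 : `|w| * `|d - v| <= 2 * (e * `|d|) by apply: ler_pM.
lra.
Qed.

Lemma clean_transversal :
  intersect_cleanly X Y Z -> intrinsically_transversal dot X Y Z.
Proof.
move=> /clean_regularity[P [r1 [P0 r10 reg]]].
have [XZ YZ] := hZ.
have [k1 /(_ Z XZ)[UX [fX [oUX CX SUX ontoX]]]] := hX.
have [k2 /(_ Z YZ)[UY [fY [oUY CY SUY ontoY]]]] := hY.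
(* The two pairings add up to at most [2 kappa (2 P + 1)] times the distance from [x] to [y], less
   than half of it. *)
pose kappa := (8 * (P + 1))^-1.
have P1 : 0 < 8 * (P + 1) by rewrite mulr_gt0// addr_gt0.
have kP : kappa * (8 * (P + 1)) = 1 by rewrite mulVf// gt_eqF.
have k0 : 0 < kappa by rewrite invr_gt0.
have k1' : kappa <= 1 by have := mulr_gt0 k0 P0; lra.
have e0 : 0 < kappa / 2 by rewrite divr_gt0.
have [rx rx0 secX] := secant_tangent oUX CX SUX ontoX e0.
have [ry ry0 secY] := secant_tangent oUY CY SUY ontoY e0.
pose r := Num.min r1 (Num.min (rx / 2) (ry / 2)).
have r0 : 0 < r by rewrite !lt_min r10 !divr_gt0.
exists kappa, [set x | `|x - Z| < r]; split.
- by rewrite k0 k1'.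
- by apply: (ball_nbhs_ex r0).
move=> x y [Xx nYx] [Yy nXy] /= xr yr.
have xy : x != y by apply: contra_notN nYx => /eqP ->.
have a0 : 0 < `|x - y| by rewrite normr_gt0 subr_eq0.
set u := `|x - y|^-1 *: (x - y).
rewrite leNgt gt_max; apply/negP => /andP[].
(* The zero vector makes the sets nonempty, so each infimum is approached by actual normal
   vectors. *)
move=> /dist_lt[|w Nw uw]; first by exists 0; exact: normal0.
move=> /dist_lt[|_ [w' Nw' <-] uw'].
  by exists (- 0); exists 0 => //; exact: normal0.
have u1 : `|u| <= 1 by rewrite normrZ normfV normr_id mulVf// gt_eqF.
move: xr yr; rewrite !lt_min => /and3P[x1 xx xyr] /and3P[y1 yx yy].
have [z [Xz Yz zZ xz yz]] := reg x y Xx Yy x1 y1.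
have n0 := normr_ge0 (x - Z); have m0 := normr_ge0 (y - Z).
have [||v Tv xv] := secX x z Xx Xz; [lra..|].
have [||v' Tv' yv] := secY y z Yy Yz; [lra..|].
have H1 := dot_near_normal (normalN Nw') Tv (ltW uw') u1 k1' (ltW e0) xv.
have H2 : dot (- u) (y - z) <= (kappa + 2 * (kappa / 2)) * `|y - z|.
  apply: (dot_near_normal (normalN Nw) Tv' _ _ k1' (ltW e0) yv).
    by rewrite -opprD normrN ltW.
  by rewrite normrN.
have H3 : dot u (x - z) + dot (- u) (y - z) = `|x - y|.
  rewrite linearNl /= -linearBr opprB addrA subrK /u linearZl /= -hdot.
  by rewrite expr2 mulrA mulVf ?mul1r// gt_eqF.
have H4 : kappa * `|x - z| <= kappa * (P * `|x - y|) by rewrite ler_wpM2l// ltW.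
have H5 : kappa * `|y - z| <= kappa * ((P + 1) * `|x - y|) by rewrite ler_wpM2l// ltW.
have H6 : 4 * (kappa * ((P + 1) * `|x - y|)) = 2^-1 * `|x - y|.
  have -> : 4 * (kappa * ((P + 1) * `|x - y|)) =
    2^-1 * (kappa * (8 * (P + 1))) * `|x - y| by field.
  by rewrite kP mulr1.
have H7 : 0 < kappa * `|x - y| by rewrite mulr_gt0.
lra.
Qed.

End CleanToTransversal.

(** * Transversality implies clean intersection *)

Section Combine.
Variables (R : realType) (E : normedVectType R).

(** The pair of maps need not be onto. Projecting to its image [W] and taking coordinates there
    makes it onto without enlarging the kernel; [A1] and [A2] are the restrictions of this
    projection to the two summands. *)
Lemma joint_onto a b (D1 : {linear E -> 'rV[R]_a}) (D2 : {linear E -> 'rV[R]_b}) :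
  exists c (A1 : {linear 'rV[R]_a -> 'rV[R]_c}) (A2 : {linear 'rV[R]_b -> 'rV[R]_c}),
    (forall w, exists v, A1 (D1 v) + A2 (D2 v) = w) /\
    (forall v, A1 (D1 v) + A2 (D2 v) = 0 -> D1 v = 0 /\ D2 v = 0).
Proof.
pose W := limg (linfun (row_map D1 D2)).
pose A : {linear 'rV[R]_(a + b) -> 'rV[R]_(dim (subvs_of W))} := v2r \o vsproj W.
have lin1 : linear (fun x : 'rV[R]_a => A (row_mx x 0)).
  by move=> t x y; rewrite -linearP scale_row_mx add_row_mx scaler0 addr0.
have lin2 : linear (fun x : 'rV[R]_b => A (row_mx 0 x)).
  by move=> t x y; rewrite -linearP scale_row_mx add_row_mx scaler0 addr0.
pose A1 : {linear 'rV[R]_a -> _} :=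
  HB.pack (fun x : 'rV[R]_a => A (row_mx x 0)) (GRing.isLinear.Build _ _ _ _ _ lin1).
pose A2 : {linear 'rV[R]_b -> _} :=
  HB.pack (fun x : 'rV[R]_b => A (row_mx 0 x)) (GRing.isLinear.Build _ _ _ _ _ lin2).
have AE v : A1 (D1 v) + A2 (D2 v) = A (row_map D1 D2 v).
  by rewrite /A1 /A2 /= -!linearD /= add_row_mx addr0 add0r.
have inW v : row_map D1 D2 v \in W by rewrite -(lfunE (row_map D1 D2)) memv_img// memvf.
exists (dim (subvs_of W)), A1, A2; split => [w|v].
  have /memv_imgP[v _ vE] : vsval (r2v w : subvs_of W) \in W by exact: subvsP.
  exists v; rewrite AE /A /=; move: vE; rewrite lfunE => <-.
  by rewrite vsvalK r2vK.
rewrite AE /A /= => /(congr1 r2v); rewrite v2rK linear0 => /(congr1 vsval).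
rewrite vsprojK// linear0 /row_map -(row_mx0 _ _ a b) => /eq_row_mx[].
by move=> D1v D2v; split.
Qed.

Lemma C1_on_combine a b c (h1 : E -> 'rV[R]_a) (h2 : E -> 'rV[R]_b)
    (A1 : {linear 'rV[R]_a -> 'rV[R]_c}) (A2 : {linear 'rV[R]_b -> 'rV[R]_c})
    (U : set E) : open U -> C1_on h1 U -> C1_on h2 U ->
  C1_on (fun y => A1 (h1 y) + A2 (h2 y)) U /\
  (forall x, U x -> forall v,
    'd (fun y => A1 (h1 y) + A2 (h2 y)) x v = A1 ('d h1 x v) + A2 ('d h2 x v)).
Proof.
move=> oU [d1 c1] [d2 c2]; set g := fun y => _.
have [K1 K10 A1K] := rV_linear_bounded A1; have [K2 K20 A2K] := rV_linear_bounded A2.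
have half (e : R) : 0 < e ->
    [/\ 0 < e / (2 * K1), 0 < e / (2 * K2),
        K1 * (e / (2 * K1)) = e / 2 & K2 * (e / (2 * K2)) = e / 2].
  move=> e0; split; rewrite ?divr_gt0 ?mulr_gt0//; field; exact: lt0r_neq0.
have dg x : U x -> differentiable g x /\
    'd g x = (A1 \o 'd h1 x) \+ (A2 \o 'd h2 x) :> (E -> _).
  move=> Ux; pose L : {linear E -> 'rV[R]_c} := (A1 \o 'd h1 x) \+ (A2 \o 'd h2 x).
  apply: (@eps_differentiable _ _ _ g x L) => [|e e0].
    exact: linear_continuous_fd.
  have [e1 e2 E1 E2] := half e e0.
  have [r1 r10 h1r] := differentiable_eps (d1 x Ux) e1.
  have [r2 r20 h2r] := differentiable_eps (d2 x Ux) e2.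
  exists (Num.min r1 r2); first by rewrite lt_min r10.
  move=> y; rewrite lt_min => /andP[/h1r y1 /h2r y2].
  have -> : g y - g x - L (y - x) = A1 (h1 y - h1 x - 'd h1 x (y - x)) +
      A2 (h2 y - h2 x - 'd h2 x (y - x)).
    rewrite 2!(linearB A1) 2!(linearB A2) /g /L /=.
    by rewrite !opprD [X in X + _ = _]addrACA [LHS]addrACA.
  have := le_trans (A1K _) (ler_wpM2l (ltW K10) y1); rewrite mulrA E1 => H1.
  have := le_trans (A2K _) (ler_wpM2l (ltW K20) y2); rewrite mulrA E2 => H2.
  by apply: le_trans (ler_normD _ _) _; lra.
split; last by move=> x Ux v; rewrite (dg x Ux).2.
split => [x /dg[]//|x Ux e e0].
have [e1 e2 E1 E2] := half e e0.
have [r1 r10 h1r] := nbhs_ball_ex (c1 x Ux _ e1).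
have [r2 r20 h2r] := nbhs_ball_ex (c2 x Ux _ e2).
have [r3 r30 rU] := nbhs_ball_ex (open_nbhs_nbhs (conj oU Ux)).
apply: (@ball_nbhs_ex _ _ _ _ (Num.min r3 (Num.min r1 r2))).
  by rewrite !lt_min r30 r10.
move=> y; rewrite !lt_min => /and3P[/rU Uy /h1r y1 /h2r y2] v.
rewrite (dg x Ux).2 (dg y Uy).2 /= opprD addrACA -!linearB.
have := le_trans (A1K _) (ler_wpM2l (ltW K10) (y1 v)); rewrite mulrA E1 => H1.
have := le_trans (A2K _) (ler_wpM2l (ltW K20) (y2 v)); rewrite mulrA E2 => H2.
by apply: le_trans (ler_normD _ _) _; lra.
Qed.

End Combine.

(** * Distance estimates on the combined zero locus *)

Section SecantNear.
Variables (R : realType) (E : normedVectType R).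

Lemma lt_half_double (p q r : R) : 0 <= p -> q <= 2 * p -> p < r / 2 -> p < r /\ q < r.
Proof. by move=> p0 qp pr; split; lra. Qed.

(** The closing arithmetic: [d <= a + C (a + b) <= e (1 + 2 C) d = d / 2]. Here [d] will be the
    distance from [s] to its nearest point in the intersection, [a] and [b] those from [s] to nearby
    points of [X] and [Y]. *)
Lemma half_contraction (C e d a b c m x : R) :
  0 < C -> e * (2 * (1 + 2 * C)) = 1 -> d <= m -> m <= a + c -> c <= C * x ->
  x <= a + b -> a <= e * d -> b <= e * d -> d <= 0.
Proof.
move=> C0 eC dm mac cx xab ad bd.
have H : C * x <= C * (2 * (e * d)) by rewrite ler_wpM2l ?(ltW C0)//; lra.
have : d <= 2^-1 * (e * (2 * (1 + 2 * C))) * d.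
  have -> : 2^-1 * (e * (2 * (1 + 2 * C))) * d = e * d + C * (2 * (e * d)) by field.
  lra.
by rewrite eC; lra.
Qed.

(** The kernel inclusion bounds ['d h z] by a multiple of ['d g z], which is small on secants of
    [T]. As [h m = 0], the value [h s] is small relative to [s - m], and metric regularity of [S]
    supplies [x]. *)
Lemma secant_near (S T : set E) (j k : nat) (h : E -> 'rV[R]_j) (g : E -> 'rV[R]_k)
    (U V : set E) (z : E) (e : R) :
  open_nbhs z U -> C1_on h U -> S `&` U = [set y | U y /\ h y = 0] ->
  (forall w, exists v, 'd h z v = w) -> S z ->
  open_nbhs z V -> C1_on g V -> T `&` V = [set y | V y /\ g y = 0] ->
  (forall v, 'd g z v = 0 -> 'd h z v = 0) -> 0 < e ->
  exists2 r : R, 0 < r & forall s m, T s -> T m -> S m ->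
    `|s - z| < r -> `|m - z| < r -> exists2 x, S x & `|x - s| <= e * `|s - m|.
Proof.
move=> oU hC SU hS Sz oV gC TV ker_gh e0.
have ker2 v : 'd g z v = 0 -> 'd g z v = 0 -> 'd h z v = 0 by move=> /ker_gh.
have [Q Q0 domQ] := linear_dominated ker2.
have [C [r1 [C0 r10 reg]]] := metric_regularity oU hC SU hS Sz.
have B0 : 0 < C * (2 * Q + 1) by rewrite mulr_gt0// addr_gt0// mulr_gt0.
pose d := e / (C * (2 * Q + 1)); have d0 : 0 < d by rewrite divr_gt0.
have dE : C * (2 * Q + 1) * d = e by rewrite /d mulrC divfK// gt_eqF.
have [r2 r20 sec] := secant_ker oV gC TV d0.
have [r3 r30 str] := C1_on_strict oU hC d0.
exists (Num.min r1 (Num.min r2 r3)); first by rewrite !lt_min r10 r20.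
move=> s m Ts Tm Sm; rewrite !lt_min => /and3P[s1 s2 s3] /and3P[m1 m2 m3].
have [x [Ux hx xs]] := reg s s1.
exists x; first exact/(modelP SU Ux).
apply: le_trans xs _; rewrite -dE -mulrA -mulrA ler_wpM2l ?(ltW C0)//.
have [Um _ _] := str m m3; have [_ _ /(_ m m3)] := str s s3.
rewrite (modelP SU Um).1// subr0 => H1.
have H2 := sec s m Ts Tm s2 m2.
have H3 := domQ (s - m).
have H4 : Q * (`|'d g z (s - m)| + `|'d g z (s - m)|) <= Q * (2 * (d * `|s - m|)).
  by rewrite ler_wpM2l ?(ltW Q0)//; lra.
have := ler_normD (h s - 'd h z (s - m)) ('d h z (s - m)); rewrite subrK.
lra.
Qed.

End SecantNear.

(** * From the slope condition to linear regularity, then to a defining function of the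
    intersection *)

Section TransversalToClean.
Variables (R : realType) (E : normedVectType R) (dot : {dot E for idfun}).
Hypothesis hdot : euclidean dot.
Variables (X Y : set E).
Hypotheses (hX : C1_embedded_submanifold X) (hY : C1_embedded_submanifold Y).
Variable Z : E.
Hypothesis hZ : (X `&` Y) Z.

Lemma pair_min (A B : set E) (x0 y0 : E) (s : R) :
  compact A -> compact B -> A x0 -> B y0 -> 0 <= s ->
  exists x y, [/\ A x, B y & forall x' y', A x' -> B y' ->
    `|x - y| + s * (`|x - x0| + `|y - y0|) <=
    `|x' - y'| + s * (`|x' - x0| + `|y' - y0|)].
Proof.
move=> cA cB Ax0 By0 s0.
have [||[x y] [/= Ax By] xymin] := @lipschitz_min R (E * E)%type (A `*` B)
   (fun p => `|p.1 - p.2| + s * (`|p.1 - x0| + `|p.2 - y0|)) (2 + 2 * s)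
   _ (compact_setX cA cB).
- by exists (x0, y0).
- move=> [x y] [x' y'] _ _ /=.
  have d1 : `|x - x'| <= `|(x, y) - (x', y')| by rewrite prod_normE le_max lexx.
  have d2 : `|y - y'| <= `|(x, y) - (x', y')| by rewrite prod_normE le_max lexx orbT.
  set d := `|(x, y) - (x', y')| in d1 d2 *.
  have e1 : `| `|x - y| - `|x' - y'| | <= 2 * d.
    apply: le_trans (ler_dist_dist _ _) _.
    rewrite opprD addrACA -opprD; apply: le_trans (ler_normB _ _) _; lra.
  have e2 : `| `|x - x0| - `|x' - x0| | <= d.
    by apply: le_trans (ler_dist_dist _ _) _; rewrite opprB subrKA.
  have e3 : `| `|y - y0| - `|y' - y0| | <= d.
    by apply: le_trans (ler_dist_dist _ _) _; rewrite opprB subrKA.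
  move: e1 e2 e3; rewrite !ler_norml => /andP[a1 b1] /andP[a2 b2] /andP[a3 b3].
  by apply/andP; split; nra.
by exists x, y; split => // x' y' Ax' By'; apply: (xymin (x', y')).
Qed.

(** If neither component of the penalised minimiser [(x, y)] lay in the intersection, [normal_slope]
    in each variable would put [u] within [s < kappa] of both normal spaces, against
    transversality. *)
Lemma transversal_regularity : intrinsically_transversal dot X Y Z ->
  exists C r : R, [/\ 0 < C, 0 < r & forall x0 y0, X x0 -> Y y0 ->
    `|x0 - Z| < r -> `|y0 - Z| < r ->
    exists m, [/\ X m, Y m & `|m - x0| <= C * `|x0 - y0|]].
Proof.
case: hZ => XZ YZ [kappa [B [/andP[k0 k1] nB IT]]].
have [kX' /(_ Z XZ)[UX [fX [oUX CX SUX _]]]] := hX.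
have [kY' /(_ Z YZ)[UY [fY [oUY CY SUY _]]]] := hY.
have [rx rx0 cX] := model_compact oUX CX SUX.
have [ry ry0 cY] := model_compact oUY CY SUY.
have [rb rb0 rB] := nbhs_ball_ex nB.
pose rho := Num.min rb (Num.min rx ry).
have rho0 : 0 < rho by rewrite !lt_min rb0 rx0.
have shrink (S : set E) r : compact (S `&` [set y | `|y - Z| <= r]) -> rho <= r ->
    compact (S `&` [set y | `|y - Z| <= rho]).
  move=> cS rr; rewrite (_ : _ `&` _ = (S `&` [set y | `|y - Z| <= r])
      `&` [set y | `|y - Z| <= rho]).
    by apply: compact_closedI => //; exact: closed_ball_norm_closed.
  apply/seteqP; split => y /= [].
    by move=> Sy yr; do !split => //; exact: le_trans rr.
  by move=> [].
have cX2 := shrink X rx cX _; have cY2 := shrink Y ry cY _.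
pose s := kappa / 2; have s0 : 0 < s by rewrite divr_gt0.
have sk : s < kappa by rewrite /s; lra.
(* Since minimality gives [s |x - x0| <= |x0 - y0| < 2 r], this choice keeps [x] within [rho / 2] of
   [x0], and likewise [y] of [y0]; so the minimiser is interior to the balls. *)
pose r := rho * s / 4; have r0 : 0 < r by rewrite divr_gt0// mulr_gt0.
have rE : 2 * r = (rho / 2) * s by rewrite /r; field.
have r8 : r <= rho / 8 by rewrite /r /s; nra.
have si0 : 0 < s^-1 by rewrite invr_gt0.
exists (s^-1 + 1), r; split => //; first by rewrite addr_gt0.
move=> x0 y0 Xx0 Yy0 x0r y0r.
have [|||||x [y [[Xx xr] [Yy yr] xymin]]] := @pair_min
  (X `&` [set y | `|y - Z| <= rho]) (Y `&` [set y | `|y - Z| <= rho]) x0 y0 s.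
- by apply: cX2; rewrite !ge_min lexx orbT.
- by apply: cY2; rewrite !ge_min lexx !orbT.
- by split => //=; lra.
- by split => //=; lra.
- exact: ltW.
have A0 : (X `&` [set y | `|y - Z| <= rho]) x0 by split => //=; lra.
have B0 : (Y `&` [set y | `|y - Z| <= rho]) y0 by split => //=; lra.
have := xymin x0 y0 A0 B0; rewrite !subrr !normr0 addr0 mulr0 addr0 => H0.
have x0y0 : `|x0 - y0| < 2 * r.
  have : `|x0 - y0| <= `|x0 - Z| + `|y0 - Z|.
    by rewrite [`|y0 - Z|]distrC -[x0 - y0](subrKA Z) ler_normD.
  lra.
have nxy := normr_ge0 (x - y); have nx := normr_ge0 (x - x0).
have ny := normr_ge0 (y - y0).
have dx : s * `|x - x0| <= `|x0 - y0| by nra.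
have dy : s * `|y - y0| <= `|x0 - y0| by nra.
have dx' : `|x - x0| <= s^-1 * `|x0 - y0| by rewrite ler_pdivlMl.
have dy' : `|y - y0| <= s^-1 * `|x0 - y0| by rewrite ler_pdivlMl.
(* The point [m] is [x] or [y]; the [+ 1] in the constant pays for reaching [y] from [x0] through
   [y0]. *)
have [Yx|nYx] := pselect (Y x).
  by exists x; split => //; rewrite mulrDl mul1r; have := normr_ge0 (x0 - y0); lra.
have [Xy|nXy] := pselect (X y).
  exists y; split => //; rewrite mulrDl mul1r.
  have : `|y - x0| <= `|y - y0| + `|x0 - y0|.
    by rewrite [`|x0 - y0|]distrC -[y - x0](subrKA y0) ler_normD.
  lra.
exfalso.
have xZ : `|x - Z| < rho.
  have : s * `|x - x0| < s * (rho / 2) by rewrite [_ * (_ / _)]mulrC -rE; lra.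
  rewrite ltr_pM2l// => H; have : `|x - Z| <= `|x - x0| + `|x0 - Z|.
    by rewrite -[x - Z](subrKA x0) ler_normD.
  lra.
have yZ : `|y - Z| < rho.
  have : s * `|y - y0| < s * (rho / 2) by rewrite [_ * (_ / _)]mulrC -rE; lra.
  rewrite ltr_pM2l// => H; have : `|y - Z| <= `|y - y0| + `|y0 - Z|.
    by rewrite -[y - Z](subrKA y0) ler_normD.
  lra.
have xy : x != y by apply: contra_notN nYx => /eqP ->.
have yx : y != x by rewrite eq_sym.
have rhob : rho <= rb by rewrite ge_min lexx.
have := IT x y (conj Xx nYx) (conj Yy nXy) (rB x _) (rB y _).
move=> /(_ (lt_le_trans xZ rhob) (lt_le_trans yZ rhob)) /=.
set u := `|x - y|^-1 *: (x - y).
rewrite leNgt gt_max => /negP; apply; apply/andP; split.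
(* With [x] frozen, the triangle inequality turns the penalty centred at [y0] into one centred at
   [y], as [normal_slope] requires. It yields a normal close to [- u], whence the sign change. *)
- have [kY2 /(_ y Yy)[V [g [oV CV SV oW]]]] := hY.
  have [|z Yz zr|w Nw uw] := @normal_slope R E dot hdot _ Y g V y x s (rho - `|y - Z|)
     oV CV oW SV Yy yx (ltW s0).
  + by rewrite subr_gt0.
  + have zZ : `|z - Z| <= rho.
      have : `|z - Z| <= `|z - y| + `|y - Z| by rewrite -[z - Z](subrKA y) ler_normD.
      lra.
    have := xymin x z (conj Xx (ltW xZ)) (conj Yz zZ).
    have : s * `|z - y0| <= s * (`|z - y| + `|y - y0|).
      by rewrite ler_wpM2l ?(ltW s0)// -[z - y0](subrKA y) ler_normD.
    by rewrite [`|y - x|]distrC [`|z - x|]distrC; lra.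
  apply: le_lt_trans sk; apply: (dist_le (normalN Nw)).
  rewrite opprK -normrN opprD; move: uw.
  by rewrite [`|y - x|]distrC -[y - x]opprB scalerN.
- have [kX2 /(_ x Xx)[V [g [oV CV SV oW]]]] := hX.
  have [|z Xz zr|w Nw uw] := @normal_slope R E dot hdot _ X g V x y s (rho - `|x - Z|)
     oV CV oW SV Xx xy (ltW s0).
  + by rewrite subr_gt0.
  + have zZ : `|z - Z| <= rho.
      have : `|z - Z| <= `|z - x| + `|x - Z| by rewrite -[z - Z](subrKA x) ler_normD.
      lra.
    have := xymin z y (conj Xz zZ) (conj Yy (ltW yZ)).
    have : s * `|z - x0| <= s * (`|z - x| + `|x - x0|).
      by rewrite ler_wpM2l ?(ltW s0)// -[z - x0](subrKA x) ler_normD.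
    lra.
  apply: le_lt_trans sk; apply: (@dist_le _ _ _ _ w) => //.
  by exists (- w); [exact: normalN | rewrite opprK].
Qed.

Lemma transversal_clean :
  intrinsically_transversal dot X Y Z -> intersect_cleanly X Y Z.
Proof.
move=> /transversal_regularity[C [r1 [C0 r10 reg]]].
have [XZ YZ] := hZ.
have [kX' /(_ Z XZ)[UX [fX [oUX CX SUX ontoX]]]] := hX.
have [kY' /(_ Z YZ)[UY [fY [oUY CY SUY ontoY]]]] := hY.
have [k [A1 [A2 [ontoA kerA]]]] := joint_onto ('d fX Z) ('d fY Z).
pose U := UX `&` UY.
have oU : open_nbhs Z U.
  by split; [apply: openI; [exact: oUX.1 | exact: oUY.1] | split; [exact: oUX.2 | exact: oUY.2]].
have CXU : C1_on fX U by apply: C1_on_subset CX => y [].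
have CYU : C1_on fY U by apply: C1_on_subset CY => y [].
have [CG dG] := C1_on_combine A1 A2 oU.1 CXU CYU.
set g := fun y => _ in CG dG.
pose T := [set y | U y /\ g y = 0].
have TU : T `&` U = [set y | U y /\ g y = 0] by apply/seteqP; split => y /= [] // [].
have MT y : X y -> Y y -> U y -> T y.
  move=> Xy Yy Uy; split => //.
  by rewrite /g (modelP SUX Uy.1).1// (modelP SUY Uy.2).1// !linear0 addr0.
have TZ : T Z by apply: MT => //; exact: oU.2.
have ontoG w : exists v, 'd g Z v = w.
  by have [v <-] := ontoA w; exists v; rewrite dG//; exact: oU.2.
have kerG v : 'd g Z v = 0 -> 'd fX Z v = 0 /\ 'd fY Z v = 0.
  by rewrite dG => [/kerA|]; last exact: oU.2.
(* The accuracy that makes [half_contraction] apply. *)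
pose e := (2 * (1 + 2 * C))^-1.
have C1 : 0 < 2 * (1 + 2 * C) by rewrite mulr_gt0// addr_gt0// mulr_gt0.
have e0 : 0 < e by rewrite invr_gt0.
have eC : e * (2 * (1 + 2 * C)) = 1 by rewrite mulVf// gt_eqF.
have e1 : e <= 1 by rewrite /e invf_le1//; lra.
have [r3 r30 nearX] :=
  secant_near oUX CX SUX ontoX XZ oU CG TU (fun v gv => (kerG v gv).1) e0.
have [r4 r40 nearY] :=
  secant_near oUY CY SUY ontoY YZ oU CG TU (fun v gv => (kerG v gv).2) e0.
have [r5 r50 ontoG'] := near_onto oU CG ontoG.
have [r6 r60 UB] := nbhs_ball_ex (open_nbhs_nbhs oU).
have [r7 r70 cX] := model_compact oUX CX SUX.
have [r8 r80 cY] := model_compact oUY CY SUY.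
have cM : compact ((X `&` Y) `&` [set y | `|y - Z| <= Num.min r7 r8]).
  rewrite (_ : _ `&` _ = ((X `&` [set y | `|y - Z| <= r7]) `&`
     (Y `&` [set y | `|y - Z| <= r8])) `&` [set y | `|y - Z| <= Num.min r7 r8]).
    apply: compact_closedI; last exact: closed_ball_norm_closed.
    apply: compact_closedI => //.
    exact: compact_closed (@norm_hausdorff _ _) cY.
  apply/seteqP; split => y /=; rewrite le_min.
    by move=> [[? ?] /andP[y7 y8]]; rewrite y7 y8.
  by move=> [[[? _] [? _]] ?].
have m78 : 0 < Num.min r7 r8 by rewrite lt_min r70.
(* Radii are halved because the point of the intersection nearest to [s] may be twice as far from
   [Z] as [s] is. *)
pose r := Num.min (Num.min (r1 / 2) (Num.min (r3 / 2) (r4 / 2)))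
   (Num.min r5 (Num.min (r6 / 2) (Num.min r7 r8 / 2))).
have r0 : 0 < r by rewrite /r !lt_min r50 !divr_gt0//= lt_min r70.
have TM s : `|s - Z| < r -> T s -> X s /\ Y s.
  rewrite /r [_ < _]lt_min [_ < Num.min r5 _]lt_min [_ < Num.min (r6 / 2) _]lt_min.
  move=> /andP[+ /and3P[s5 s6 s78]]; rewrite !lt_min => /and3P[s1 s3 s4] Ts.
  have [z [[Xz Yz] zmin zZ]] := nearest_point hZ cM s78.
  have [_ z3] := lt_half_double (normr_ge0 _) zZ s3.
  have [_ z4] := lt_half_double (normr_ge0 _) zZ s4.
  have [_ z6] := lt_half_double (normr_ge0 _) zZ s6.
  have [s3' _] := lt_half_double (normr_ge0 _) zZ s3.
  have [s4' _] := lt_half_double (normr_ge0 _) zZ s4.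
  have Tz := MT z Xz Yz (UB z z6).
  have szZ : `|s - z| <= `|s - Z| by exact: zmin.
  have [x0 Xx0 x0s] := nearX s z Ts Tz Xz s3' z3.
  have [y0 Yy0 y0s] := nearY s z Ts Tz Yz s4' z4.
  have close x : `|x - s| <= e * `|s - z| -> `|x - Z| < r1.
    move=> xs; rewrite -[x - Z](subrKA s) (splitr r1).
    apply: le_lt_trans (ler_normD _ _) _; apply: ler_ltD => //.
    apply: le_trans xs _; apply: ltW; apply: le_lt_trans s1.
    apply: le_trans szZ; exact: ler_piMl.
  (* The points [x0] and [y0] are both very close to [s], so [m] lies in the intersection at
     distance at most half of that from [s] to [z]; as [z] is nearest, [s = z]. *)
  have [m [Xm Ym mx0]] := reg x0 y0 Xx0 Yy0 (close x0 x0s) (close y0 y0s).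
  suff -> : s = z by [].
  apply/eqP; rewrite -subr_eq0 -normr_le0.
  have sm := zmin m (conj Xm Ym).
  have sm2 : `|s - m| <= `|x0 - s| + `|m - x0|.
    by rewrite [`|s - m|]distrC [leRHS]addrC -[m - s](subrKA x0) ler_normD.
  have xy0 : `|x0 - y0| <= `|x0 - s| + `|y0 - s|.
    by rewrite [`|y0 - s|]distrC -[x0 - y0](subrKA s) ler_normD.
  exact: (half_contraction C0 eC sm sm2 mx0 xy0 x0s y0s).
pose B := [set y : E | `|y - Z| < r].
have oB : open_nbhs Z B.
  split; last by rewrite /B/= subrr normr0.
  rewrite (_ : B = ball Z r); first exact: ball_open.
  by apply/seteqP; split => t; rewrite -ball_normE /B /ball_ /= distrC.
have BU y : B y -> U y.
  rewrite /B /= /r !lt_min => /andP[_ /andP[_ /andP[y6 _]]]; apply: UB.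
  by apply: lt_le_trans y6 _; rewrite ler_pdivrMr// ler_peMr ?(ltW r60)// ler1n.
have Bonto y : B y -> forall w, exists v, 'd g y v = w.
  move=> By; apply: ontoG'; apply: lt_le_trans By _.
  by rewrite /r !ge_min lexx !orbT.
have CB : C1_on g B by apply: C1_on_subset CG.
have gM y : B y -> g y = 0 -> (X `&` Y) y.
  by move=> By gy; apply: TM => //; split => //; exact: BU.
exists B; split => //.
  exists k => x [_ Bx]; exists B, g; split => //.
  - by split; [exact: oB.1 | exact: Bx].
  - apply/seteqP; split => y /=.
      by move=> [[[Xy Yy] By] _]; split => //; exact: (MT y Xy Yy (BU y By)).2.
    by move=> [By gy]; split => //; split => //; exact: gM.
  - exact: Bonto.
move=> x [[Xx Yx] Bx]; have Ux := BU x Bx.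
have sub (S : set E) v : X `&` Y `<=` S -> tangent (X `&` Y) x v -> tangent S x v.
  by move=> MS [I [c [? ? cS ? ?]]]; exists I, c; split => // t /cS /MS.
apply/seteqP; split => v.
  by move=> Tv; split; apply: sub Tv => y [].
(* A common tangent vector is killed by both differentials at [x], hence by that of [g], which
   defines the intersection within [B]. *)
move=> [TXv TYv].
have vX : 'd fX x v = 0.
  apply: (tangent_ker _ CX _ Xx TXv); first by split; [exact: oUX.1 | exact: Ux.1].
  by move=> y Xy Uy; exact: (modelP SUX Uy).1.
have vY : 'd fY x v = 0.
  apply: (tangent_ker _ CY _ Yx TYv); first by split; [exact: oUY.1 | exact: Ux.2].
  by move=> y Yy Uy; exact: (modelP SUY Uy).1.
apply: (@ker_tangent _ _ _ _ g B) => //.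
- by split; [exact: oB.1 | exact: Bx].
- exact: Bonto.
- exact: (MT x Xx Yx Ux).2.
- by rewrite dG// vX vY !linear0 addr0.
Qed.

End TransversalToClean.

Theorem theorem5p1 (R : realType) (E : normedVectType R)
    (dot : {dot E for idfun}) (hdot : euclidean dot)
    (X Y : set E) (hX : C1_embedded_submanifold X)
    (hY : C1_embedded_submanifold Y)
    (Z : E) (hZ : (X `&` Y) Z) :
  intrinsically_transversal dot X Y Z <-> intersect_cleanly X Y Z.
Proof.
split; first exact: transversal_clean.
exact: clean_transversal.
Qed.
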